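(* For $g\in H(D)$ consider the Volterra operator $T_g:H(D)\to H(D)$, where $T_g(f)$ is the antiderivative of $fg'$ vanishing at $0$, for any $f\in H(D)$. Consider the sets $$Y_1(g)=\{f\in A(D): T_g(f)\notin H^\infty(D)\},\qquad Y_2(g)=\{f\in A(D): T_g(f)\notin A(D)\},$$ $$Y_3(g)=\{f\in H^\infty(D): T_g(f)\notin H^\infty(D)\},\qquad Y_4(g)=\{f\in H^\infty(D): T_g(f)\notin A(D)\}.$$ Then, for every $g\in H(D)$: (i) if $Y_1(g)\neq\emptyset$, then $Y_1(g)$ is dense and $G_\delta$ in $A(D)$ and $Y_2(g)$ is residual in $A(D)$; (ii) if $Y_3(g)\neq\emptyset$, then $Y_3(g)$ is dense and $G_\delta$ in $H^\infty(D)$ and $Y_4(g)$ is residual in $H^\infty(D)$.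
   Context: $D=\{z\in\mathbb{C}:|z|<1\}$. $H(D)$ is the space of holomorphic functions on $D$, $H^\infty(D)$ the space of bounded holomorphic functions on $D$, and $A(D)$ the space of functions holomorphic on $D$ which extend continuously to $\overline{D}$; $H^\infty(D)$ and $A(D)$ are endowed with the supremum norm. A set is residual if it contains a dense $G_\delta$ set. *)

(* Defs.v *)
From Stdlib Require Import Reals Lra Classical ClassicalEpsilon.
From Stdlib Require Import FunctionalExtensionality ProofIrrelevance.
From Coquelicot Require Export Coquelicot.

Open Scope R_scope.

Definition disc (z : C) : Prop := Cmod z < 1.
Definition closed_disc (z : C) : Prop := Cmod z <= 1.

Definition holomorphic_on_disc (f : C -> C) : Prop :=
  forall z, disc z -> ex_derive f z.

Definition bounded_on_disc (f : C -> C) : Prop :=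
  exists M : R, forall z, disc z -> Cmod (f z) <= M.

Definition extends_continuously (f : C -> C) : Prop :=
  exists F : C -> C,
    continuous_on closed_disc F /\ forall z, disc z -> F z = f z.

(* A function on the disc is encoded as a function on [C] that is [0] off the
   disc, so that Leibniz equality is equality of functions on the disc. *)
Record HD : Type := mkHD {
  HD_fun :> C -> C;
  HD_holo : holomorphic_on_disc HD_fun;
  HD_off : forall z, ~ disc z -> HD_fun z = 0%C }.

Lemma HD_ext (f g : HD) : (forall z, f z = g z) -> f = g.
Proof.
destruct f as [f Hf Of], g as [g Hg Og]; simpl; intros H.
assert (E : f = g) by (apply functional_extensionality; exact H).
subst g; f_equal; apply proof_irrelevance.
Qed.

Lemma HD_zero_holo : holomorphic_on_disc (fun _ => RtoC 0).
Proof. intros z _; apply (@ex_derive_const C_AbsRing C_NormedModule). Qed.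

Lemma HD_plus_holo (f g : HD) : holomorphic_on_disc (fun z => f z + g z)%C.
Proof.
intros z Hz.
apply (@ex_derive_plus C_AbsRing C_NormedModule); apply HD_holo; exact Hz.
Qed.

Lemma HD_scal_holo (c : C) (f : HD) : holomorphic_on_disc (fun z => c * f z)%C.
Proof.
intros z Hz; destruct (HD_holo f z Hz) as [l Hl].
exists (c * l)%C.
apply (@filterdiff_ext_lin C_AbsRing (AbsRing_NormedModule C_AbsRing)
  C_NormedModule (@locally (AbsRing_UniformSpace C_AbsRing) z)
  _ _ (fun y : C => (c * (y * l))%C)).
- exact (@filterdiff_scal_r_fct C_AbsRing (AbsRing_NormedModule C_AbsRing)
    C_NormedModule (@locally (AbsRing_UniformSpace C_AbsRing) z)
    _ c f (fun y : C => (y * l)%C) Cmult_comm Hl).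
- intros y; change (c * (y * l) = y * (c * l))%C; ring.
Qed.

Lemma HD_zero_off (z : C) : ~ disc z -> (fun _ : C => RtoC 0) z = RtoC 0.
Proof. reflexivity. Qed.

Lemma HD_plus_off (f g : HD) (z : C) : ~ disc z -> (f z + g z)%C = 0%C.
Proof. intros Hz; rewrite !HD_off by exact Hz; ring. Qed.

Lemma HD_scal_off (c : C) (f : HD) (z : C) : ~ disc z -> (c * f z)%C = 0%C.
Proof. intros Hz; rewrite HD_off by exact Hz; ring. Qed.

Definition HD_zero : HD := mkHD _ HD_zero_holo HD_zero_off.
Definition HD_plus (f g : HD) : HD :=
  mkHD _ (HD_plus_holo f g) (HD_plus_off f g).
Definition HD_scal (c : C) (f : HD) : HD :=
  mkHD _ (HD_scal_holo c f) (HD_scal_off c f).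

(* The supremum is finite exactly for bounded functions; it is only used
   for these. *)
Definition sup_norm (f : C -> C) : R :=
  real (Lub_Rbar (fun r => exists z, disc z /\ r = Cmod (f z))).

Lemma sup_norm_ub (f : C -> C) (z : C) :
  bounded_on_disc f -> disc z -> Cmod (f z) <= sup_norm f.
Proof.
intros [M HM] Hz; unfold sup_norm.
destruct (Lub_Rbar_correct (fun r => exists z, disc z /\ r = Cmod (f z)))
  as [Hub Hlub].
assert (H1 := Hub (Cmod (f z)) (ex_intro _ z (conj Hz eq_refl))).
assert (H2 : Rbar_le
  (Lub_Rbar (fun r => exists z, disc z /\ r = Cmod (f z))) M).
{ apply Hlub; intros r [w [Hw ->]]; exact (HM w Hw). }
destruct (Lub_Rbar _) as [l| |]; simpl in *; tauto.
Qed.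

Lemma sup_norm_le (f : C -> C) (M : R) :
  (forall z, disc z -> Cmod (f z) <= M) -> sup_norm f <= M.
Proof.
intros HM; unfold sup_norm.
destruct (Lub_Rbar_correct (fun r => exists z, disc z /\ r = Cmod (f z)))
  as [Hub Hlub].
assert (D0 : disc 0%C) by (unfold disc; rewrite Cmod_0; lra).
assert (H1 := Hub (Cmod (f 0%C)) (ex_intro _ (RtoC 0) (conj D0 eq_refl))).
assert (H2 : Rbar_le
  (Lub_Rbar (fun r => exists z, disc z /\ r = Cmod (f z))) M).
{ apply Hlub; intros r [w [Hw ->]]; exact (HM w Hw). }
destruct (Lub_Rbar _) as [l| |]; simpl in *; tauto.
Qed.

Record bounded_subspace : Type := mkBS {
  bs_pred :> HD -> Prop;
  bs_zero : bs_pred HD_zero;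
  bs_plus : forall f g, bs_pred f -> bs_pred g -> bs_pred (HD_plus f g);
  bs_scal : forall c f, bs_pred f -> bs_pred (HD_scal c f);
  bs_bounded : forall f, bs_pred f -> bounded_on_disc f }.

Record bs_elt (S : bounded_subspace) : Type := mkElt {
  bs_val :> HD;
  bs_in : S bs_val }.
Arguments mkElt {S} _ _.
Arguments bs_val {S} _.
Arguments bs_in {S} _.

Section SupNormedSpace.

Variable S : bounded_subspace.

Lemma bs_ext (f g : bs_elt S) : (forall z, f z = g z) -> f = g.
Proof.
destruct f as [f Hf], g as [g Hg]; simpl; intros H.
assert (E : f = g) by (apply HD_ext; exact H).
subst g; f_equal; apply proof_irrelevance.
Qed.

Definition elt_zero : bs_elt S := mkElt HD_zero (bs_zero S).
Definition elt_plus (f g : bs_elt S) : bs_elt S :=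
  mkElt (HD_plus f g) (bs_plus S f g (bs_in f) (bs_in g)).
Definition elt_scal (c : C) (f : bs_elt S) : bs_elt S :=
  mkElt (HD_scal c f) (bs_scal S c f (bs_in f)).
Definition elt_opp (f : bs_elt S) : bs_elt S := elt_scal (- (1))%C f.
Definition elt_norm (f : bs_elt S) : R := sup_norm f.

Lemma elt_plus_comm f g : elt_plus f g = elt_plus g f.
Proof. apply bs_ext; intros z; simpl; ring. Qed.
Lemma elt_plus_assoc f g h :
  elt_plus f (elt_plus g h) = elt_plus (elt_plus f g) h.
Proof. apply bs_ext; intros z; simpl; ring. Qed.
Lemma elt_plus_zero f : elt_plus f elt_zero = f.
Proof. apply bs_ext; intros z; simpl; ring. Qed.
Lemma elt_plus_opp f : elt_plus f (elt_opp f) = elt_zero.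
Proof. apply bs_ext; intros z; simpl; ring. Qed.

Definition elt_AbelianMonoid_mixin : AbelianMonoid.mixin_of (bs_elt S) :=
  AbelianMonoid.Mixin _ elt_plus elt_zero
    elt_plus_comm elt_plus_assoc elt_plus_zero.
Canonical elt_AbelianMonoid :=
  AbelianMonoid.Pack (bs_elt S) elt_AbelianMonoid_mixin (bs_elt S).

Definition elt_AbelianGroup_mixin : AbelianGroup.mixin_of elt_AbelianMonoid :=
  AbelianGroup.Mixin elt_AbelianMonoid elt_opp elt_plus_opp.
Canonical elt_AbelianGroup :=
  AbelianGroup.Pack (bs_elt S)
    (AbelianGroup.Class _ _ elt_AbelianGroup_mixin) (bs_elt S).

Lemma elt_scal_assoc (a b : C) f :
  elt_scal a (elt_scal b f) = elt_scal (a * b)%C f.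
Proof. apply bs_ext; intros z; simpl; ring. Qed.
Lemma elt_scal_one f : elt_scal 1%C f = f.
Proof. apply bs_ext; intros z; simpl; ring. Qed.
Lemma elt_scal_plus_r (a : C) f g :
  elt_scal a (elt_plus f g) = elt_plus (elt_scal a f) (elt_scal a g).
Proof. apply bs_ext; intros z; simpl; ring. Qed.
Lemma elt_scal_plus_l (a b : C) f :
  elt_scal (a + b)%C f = elt_plus (elt_scal a f) (elt_scal b f).
Proof. apply bs_ext; intros z; simpl; ring. Qed.

Definition elt_ModuleSpace_mixin :
    ModuleSpace.mixin_of C_Ring elt_AbelianGroup :=
  ModuleSpace.Mixin C_Ring elt_AbelianGroup elt_scal
    elt_scal_assoc elt_scal_one elt_scal_plus_r elt_scal_plus_l.
Canonical elt_ModuleSpace :=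
  ModuleSpace.Pack C_Ring (bs_elt S)
    (ModuleSpace.Class _ _ _ elt_ModuleSpace_mixin) (bs_elt S).

Lemma elt_norm_ub (f : bs_elt S) z : disc z -> Cmod (f z) <= elt_norm f.
Proof. apply sup_norm_ub, (bs_bounded S), bs_in. Qed.

Lemma elt_norm_triangle (f g : bs_elt S) :
  elt_norm (plus f g) <= elt_norm f + elt_norm g.
Proof.
apply sup_norm_le; intros z Hz; simpl.
eapply Rle_trans; [apply Cmod_triangle|].
apply Rplus_le_compat; apply elt_norm_ub; exact Hz.
Qed.

Lemma elt_norm_scal (c : C_AbsRing) (f : bs_elt S) :
  elt_norm (scal c f) <= abs c * elt_norm f.
Proof.
apply sup_norm_le; intros z Hz; simpl; rewrite Cmod_mult.
apply Rmult_le_compat_l; [apply Cmod_ge_0 | apply elt_norm_ub; exact Hz].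
Qed.

Lemma elt_norm_zero (f : bs_elt S) : elt_norm f = 0 -> f = zero.
Proof.
intros H; apply bs_ext; intros z; simpl.
destruct (Rlt_dec (Cmod z) 1) as [Hz|Hz].
- apply Cmod_eq_0; apply Rle_antisym; [|apply Cmod_ge_0].
  rewrite <- H; apply elt_norm_ub; exact Hz.
- apply HD_off; exact Hz.
Qed.

Definition elt_ball (f : bs_elt S) (eps : R) (g : bs_elt S) : Prop :=
  elt_norm (minus g f) < eps.

Lemma elt_ball_center (f : bs_elt S) (eps : posreal) : elt_ball f eps f.
Proof.
apply Rle_lt_trans with 0; [|apply cond_pos].
apply sup_norm_le; intros z _; simpl.
replace (f z + - (1) * f z)%C with (RtoC 0) by ring; rewrite Cmod_0; lra.
Qed.

Lemma elt_ball_sym (f g : bs_elt S) (eps : R) :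
  elt_ball f eps g -> elt_ball g eps f.
Proof.
intros H; eapply Rle_lt_trans; [|exact H].
apply sup_norm_le; intros z Hz; simpl.
eapply Rle_trans; [|apply elt_norm_ub; exact Hz]; simpl.
rewrite <- Cmod_opp; right; f_equal; ring.
Qed.

Lemma elt_ball_triangle (f g h : bs_elt S) (e1 e2 : R) :
  elt_ball f e1 g -> elt_ball g e2 h -> elt_ball f (e1 + e2) h.
Proof.
unfold elt_ball; intros H1 H2.
replace (minus h f) with (plus (minus g f) (minus h g)).
- eapply Rle_lt_trans; [apply elt_norm_triangle | lra].
- apply bs_ext; intros z; simpl; ring.
Qed.

Definition elt_UniformSpace_mixin : UniformSpace.mixin_of (bs_elt S) :=
  UniformSpace.Mixin _ elt_zero elt_ball
    elt_ball_center elt_ball_sym elt_ball_triangle.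
Canonical elt_UniformSpace :=
  UniformSpace.Pack (bs_elt S) elt_UniformSpace_mixin (bs_elt S).

Canonical elt_NormedModuleAux :=
  NormedModuleAux.Pack C_AbsRing (bs_elt S)
    (NormedModuleAux.Class C_AbsRing _
       (ModuleSpace.class _ elt_ModuleSpace) elt_UniformSpace_mixin)
    (bs_elt S).

Lemma elt_norm_compat1 (f g : bs_elt S) (eps : R) :
  elt_norm (minus g f) < eps -> ball f eps g.
Proof. intros H; exact H. Qed.

Lemma elt_norm_compat2 (f g : bs_elt S) (eps : posreal) :
  ball f eps g -> elt_norm (minus g f) < 1 * eps.
Proof. intros H; rewrite Rmult_1_l; exact H. Qed.

Definition elt_NormedModule_mixin :
    NormedModule.mixin_of C_AbsRing elt_NormedModuleAux :=
  NormedModule.Mixin C_AbsRing elt_NormedModuleAux elt_norm 1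
    elt_norm_triangle elt_norm_scal elt_norm_compat1 elt_norm_compat2
    elt_norm_zero.
Canonical elt_NormedModule :=
  NormedModule.Pack C_AbsRing (bs_elt S)
    (NormedModule.Class _ _ _ elt_NormedModule_mixin) (bs_elt S).

End SupNormedSpace.

Definition in_Hinf (f : HD) : Prop := bounded_on_disc f.
Definition in_AD (f : HD) : Prop := extends_continuously f.

Lemma in_Hinf_zero : in_Hinf HD_zero.
Proof. exists 0; intros z _; simpl; rewrite Cmod_0; lra. Qed.

Lemma in_Hinf_plus f g : in_Hinf f -> in_Hinf g -> in_Hinf (HD_plus f g).
Proof.
intros [M HM] [N HN]; exists (M + N); intros z Hz; simpl.
eapply Rle_trans; [apply Cmod_triangle|].
apply Rplus_le_compat; auto.
Qed.

Lemma in_Hinf_scal c f : in_Hinf f -> in_Hinf (HD_scal c f).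
Proof.
intros [M HM]; exists (Cmod c * M); intros z Hz; simpl; rewrite Cmod_mult.
apply Rmult_le_compat_l; [apply Cmod_ge_0 | auto].
Qed.

Lemma in_AD_zero : in_AD HD_zero.
Proof.
exists (fun _ => RtoC 0); split; [|reflexivity].
intros z _; apply filterlim_const.
Qed.

Lemma in_AD_plus f g : in_AD f -> in_AD g -> in_AD (HD_plus f g).
Proof.
intros [F [CF EF]] [G [CG EG]].
exists (fun z => F z + G z)%C; split.
- intros z Hz.
  eapply filterlim_comp_2; [exact (CF z Hz) | exact (CG z Hz) |].
  exact (@filterlim_plus C_AbsRing C_NormedModule (F z) (G z)).
- intros z Hz; simpl; rewrite EF, EG by exact Hz; reflexivity.
Qed.

Lemma in_AD_scal c f : in_AD f -> in_AD (HD_scal c f).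
Proof.
intros [F [CF EF]].
exists (fun z => c * F z)%C; split.
- intros z Hz.
  eapply filterlim_comp; [exact (CF z Hz) |].
  exact (@filterlim_scal_r C_AbsRing C_NormedModule c (F z)).
- intros z Hz; simpl; rewrite EF by exact Hz; reflexivity.
Qed.

Lemma Cmod_fst_snd_le (z : C) : Cmod z <= Rabs (fst z) + Rabs (snd z).
Proof.
replace z with (RtoC (fst z) + (0, snd z))%C at 1
  by (destruct z; unfold RtoC, Cplus; simpl; f_equal; ring).
eapply Rle_trans; [apply Cmod_triangle|].
rewrite Cmod_R; apply Rplus_le_compat_l; right.
unfold Cmod; simpl.
replace (0 * (0 * 1) + snd z * (snd z * 1)) with (Rsqr (snd z))
  by (unfold Rsqr; ring).
apply sqrt_Rsqr_abs.
Qed.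

Lemma locally_bounded_closed_disc (F : C -> C) (u v : R) :
  continuous_on closed_disc F ->
  exists d : posreal, forall x y : R, closed_disc (x, y) ->
    Rabs (x - u) < d -> Rabs (y - v) < d -> Cmod (F (x, y)) <= / d.
Proof.
intros CF.
destruct (classic (closed_disc (u, v))) as [H|H].
- assert (L : locally (F (u, v)) (fun w : C => Cmod (minus w (F (u, v))) < 1)).
  { apply (@locally_le_locally_norm C_AbsRing C_NormedModule).
    exists (mkposreal 1 Rlt_0_1); intros w Hw; exact Hw. }
  specialize (CF _ H _ L); destruct CF as [e He].
  assert (M0 : 0 < 1 + Cmod (F (u, v)))
    by (generalize (Cmod_ge_0 (F (u, v))); lra).
  assert (D0 : 0 < Rmin e (/ (1 + Cmod (F (u, v))))).
  { apply Rmin_pos; [apply cond_pos | apply Rinv_0_lt_compat; exact M0]. }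
  exists (mkposreal _ D0); simpl; intros x y Hxy Hx Hy.
  assert (B : Cmod (minus (F (x, y)) (F (u, v))) < 1).
  { apply He; [|exact Hxy].
    split; [exact (Rlt_le_trans _ _ _ Hx (Rmin_l _ _))
           |exact (Rlt_le_trans _ _ _ Hy (Rmin_l _ _))]. }
  apply Rle_trans with (1 + Cmod (F (u, v))).
  + replace (F (x, y)) with (minus (F (x, y)) (F (u, v)) + F (u, v))%C
      by (unfold minus, plus, opp; simpl; ring).
    eapply Rle_trans; [apply Cmod_triangle | lra].
  + rewrite <- (Rinv_inv (1 + Cmod (F (u, v)))) at 1.
    apply Rinv_le_contravar; [exact D0 | apply Rmin_r].
- assert (D0 : 0 < (Cmod (u, v) - 1) / 2) by (unfold closed_disc in H; lra).
  exists (mkposreal _ D0); simpl; intros x y Hxy Hx Hy; exfalso.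
  assert (T : Cmod (u, v) <= Cmod (x, y) + Cmod (u - x, v - y)).
  { eapply Rle_trans; [|apply Cmod_triangle]; right; f_equal.
    unfold Cplus; simpl; f_equal; ring. }
  assert (T' := Cmod_fst_snd_le (u - x, v - y)); simpl in T'.
  rewrite Rabs_minus_sym in Hx, Hy.
  unfold closed_disc in Hxy; lra.
Qed.

Lemma in_AD_bounded f : in_AD f -> bounded_on_disc f.
Proof.
intros [F [CF EF]].
set (P := fun u v => locally_bounded_closed_disc F u v CF).
set (delta := fun u v => proj1_sig (constructive_indefinite_description _ (P u v))).
assert (Hdelta : forall u v x y, closed_disc (x, y) ->
  Rabs (x - u) < delta u v -> Rabs (y - v) < delta u v ->
  Cmod (F (x, y)) <= / delta u v).
{ intros u v; unfold delta.
  exact (proj2_sig (constructive_indefinite_description _ (P u v))). }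
destruct (compactness_value_2d (-1) 1 (-1) 1 delta) as [d Hd].
exists (/ d); intros [x y] Hz; rewrite <- EF by exact Hz.
assert (X : Rabs x <= 1 /\ Rabs y <= 1).
{ generalize (Rmax_Cmod (x, y)); simpl; unfold disc in Hz.
  generalize (Rmax_l (Rabs x) (Rabs y)) (Rmax_r (Rabs x) (Rabs y)); lra. }
destruct X as [X Y]; apply Rabs_le_between in X; apply Rabs_le_between in Y.
destruct (NNPP _ (Hd x y X Y)) as [u [v [_ [_ [Hu [Hv Hle]]]]]].
eapply Rle_trans; [apply (Hdelta u v); [left; exact Hz | exact Hu | exact Hv]|].
apply Rinv_le_contravar; [apply cond_pos | exact Hle].
Qed.

Definition Hinf_subspace : bounded_subspace :=
  mkBS in_Hinf in_Hinf_zero in_Hinf_plus in_Hinf_scal (fun f H => H).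
Definition AD_subspace : bounded_subspace :=
  mkBS in_AD in_AD_zero in_AD_plus in_AD_scal in_AD_bounded.

Notation Hinf := (bs_elt Hinf_subspace).
Notation AD := (bs_elt AD_subspace).

(* [epsilon] selects the unique antiderivative of [f g'] vanishing at [0]; as
   the disc is simply connected, one exists for all [f] and [g]. *)
Definition volterra (g f : HD) : HD :=
  epsilon (inhabits HD_zero) (fun F : HD =>
    F 0%C = 0%C /\
    forall z, disc z -> is_derive F z (f z * C_derive g z)%C).

Definition Y1 (g : HD) (f : AD) : Prop := ~ in_Hinf (volterra g f).
Definition Y2 (g : HD) (f : AD) : Prop := ~ in_AD (volterra g f).
Definition Y3 (g : HD) (f : Hinf) : Prop := ~ in_Hinf (volterra g f).
Definition Y4 (g : HD) (f : Hinf) : Prop := ~ in_AD (volterra g f).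

Definition dense {T : UniformSpace} (S : T -> Prop) : Prop :=
  forall U : T -> Prop, open U -> (exists x, U x) -> exists x, U x /\ S x.

Definition G_delta {T : UniformSpace} (S : T -> Prop) : Prop :=
  exists U : nat -> T -> Prop,
    (forall n, open (U n)) /\ forall x, S x <-> forall n, U n x.

Definition residual {T : UniformSpace} (S : T -> Prop) : Prop :=
  exists G : T -> Prop, dense G /\ G_delta G /\ forall x, G x -> S x.

(* Main.v *)
From Stdlib Require Import Reals Lra Classical ClassicalEpsilon.
Require Import Defs.

(* Write [T f] for the antiderivative of [f g'] vanishing at [0].  If [T f1] is
   unbounded and [T f0] is bounded, then [T (f0 + c f1)] is unbounded for every
   [c <> 0], hence the functions with unbounded image are dense.  They are the
   intersection over [n] of the unions over [z] of [{f : |T f z| > n}], which are open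
   because [T f z] is the integral of [f g'] along [[0, z]], and so is continuous
   in [f] for the supremum norm.  That this integral is an antiderivative is Goursat's
   theorem for [f g'], and [g'] is holomorphic by Cauchy's formula.  Both come from
   Goursat's theorem on a cone over a curve, the curve being a segment or a circle. *)

Open Scope R_scope.

(** Since [volterra] picks its value by [epsilon], nothing is known about it until an antiderivative
    of [f g'] has been shown to exist; this is why Cauchy theory fills most of the proof. Cones are
    parametrised by rectangles, so a single subdivision argument handles straight and curved sides
    alike, and a boundary integral is just four real integrals. The open sets are unions over [z]
    because [f -> T f z] is bounded by a constant that depends on [z]. The residual statements
    follow because a function in [A(D)] is bounded, so that [Y1] lies in [Y2] and [Y3] in [Y4]. *)

(** * Differentiation and continuity *)

(** The quotient-free form makes sense at [w = z] too and lets all estimates run on [Cmod]. [rderiv]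
    and [ccont] are the counterparts for curves. *)
Definition cderiv (f : C -> C) (z l : C) : Prop :=
  forall eps : R, 0 < eps -> exists delta : R, 0 < delta /\
    forall w, Cmod (w - z) < delta ->
      Cmod (f w - f z - l * (w - z)) <= eps * Cmod (w - z).

Definition rderiv (c : R -> C) (t : R) (v : C) : Prop :=
  forall eps : R, 0 < eps -> exists delta : R, 0 < delta /\
    forall u, Rabs (u - t) < delta ->
      Cmod (c u - c t - v * (u - t)%R) <= eps * Rabs (u - t).

Definition ccont (c : R -> C) (t : R) : Prop :=
  forall eps : R, 0 < eps -> exists delta : R, 0 < delta /\
    forall u, Rabs (u - t) < delta -> Cmod (c u - c t) < eps.

Lemma Cmod_sub_sym (z w : C) : Cmod (z - w) = Cmod (w - z).
Proof. rewrite <- Cmod_opp; f_equal; ring. Qed.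

Lemma Cmod_sub_triangle (z w : C) : Cmod (z - w) <= Cmod z + Cmod w.
Proof. unfold Cminus; rewrite <- (Cmod_opp w); apply Cmod_triangle. Qed.

Lemma Cmod_triangle_inv (z w : C) : Cmod z - Cmod w <= Cmod (z - w).
Proof.
replace z with ((z - w) + w)%C at 1 by ring.
generalize (Cmod_triangle (z - w) w); lra.
Qed.

Lemma is_derive_cderiv (f : C -> C) (z l : C) :
  is_derive f z l <-> cderiv f z l.
Proof.
split.
- intros [_ H] eps Heps.
  specialize (H z (fun P HP => HP) (mkposreal eps Heps)).
  destruct H as [delta H].
  exists delta; split; [apply cond_pos|]; intros w Hw.
  specialize (H w Hw); simpl in H.
  replace (f w - f z - l * (w - z))%C with
    (minus (minus (f w) (f z)) (scal (minus w z) l))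
    by (unfold minus, plus, opp, scal; simpl; unfold mult; simpl; ring).
  exact H.
- intros H; split.
  + apply (@is_linear_scal_l C_AbsRing C_NormedModule).
  + intros x Hx.
    assert (E : z = x).
    { apply (@is_filter_lim_locally_unique C_AbsRing (AbsRing_NormedModule C_AbsRing)).
      exact Hx. }
    subst x; intros eps.
    destruct (H eps (cond_pos eps)) as [delta [Hd H']].
    exists (mkposreal delta Hd); intros w Hw.
    specialize (H' w Hw).
    replace (f w - f z - l * (w - z))%C with
      (minus (minus (f w) (f z)) (scal (minus w z) l)) in H'
      by (unfold minus, plus, opp, scal; simpl; unfold mult; simpl; ring).
    exact H'.
Qed.

Lemma ex_derive_cderiv (f : C -> C) (z : C) :
  ex_derive f z <-> exists l, cderiv f z l.
Proof.
split; intros [l H]; exists l; apply is_derive_cderiv; exact H.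
Qed.

(** Integration uses the structure of [C] as a real product space; this lemma and [scal_C_R]
    translate it back to complex arithmetic. *)
Lemma norm_C_R (z : C) : @norm R_AbsRing C_R_NormedModule z = Cmod z.
Proof.
unfold norm; simpl; unfold prod_norm, Cmod; f_equal.
unfold norm, abs; simpl.
destruct z as [x y]; simpl.
rewrite 2!Rmult_1_r, <- 2!Rabs_mult, 2!Rabs_right; try ring; nra.
Qed.

Lemma scal_C_R (x : R) (z : C) :
  @scal R_AbsRing C_R_NormedModule x z = (RtoC x * z)%C.
Proof.
destruct z as [u v]; unfold scal; simpl; unfold prod_scal, Cmult, RtoC; simpl.
unfold scal; simpl; unfold mult; simpl; f_equal; ring.
Qed.

Lemma rderiv_is_derive (c : R -> C) (t : R) (v : C) :
  rderiv c t v -> @is_derive R_AbsRing C_R_NormedModule c t v.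
Proof.
intros H; split.
- apply (@is_linear_scal_l R_AbsRing C_R_NormedModule).
- intros x Hx.
  assert (E : t = x).
  { apply (@is_filter_lim_locally_unique R_AbsRing R_NormedModule); exact Hx. }
  subst x; intros eps.
  destruct (H eps (cond_pos eps)) as [delta [Hd H']].
  exists (mkposreal delta Hd); intros u Hu.
  specialize (H' u Hu).
  rewrite norm_C_R, scal_C_R.
  replace (c u - c t - v * (u - t)%R)%C with
    (minus (minus (c u) (c t)) (RtoC (minus u t) * v)%C) in H'
    by (unfold minus, plus, opp; simpl; rewrite RtoC_minus, RtoC_plus, RtoC_opp; ring).
  exact H'.
Qed.

Lemma ccont_continuous (c : R -> C) (t : R) :
  ccont c t -> @continuous R_UniformSpace (NormedModule.UniformSpace R_AbsRing C_R_NormedModule) c t.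
Proof.
intros H; apply filterlim_locally; intros eps.
destruct (H eps (cond_pos eps)) as [delta [Hd H']].
exists (mkposreal delta Hd); intros u Hu.
apply (@norm_compat1 R_AbsRing C_R_NormedModule).
rewrite norm_C_R; exact (H' u Hu).
Qed.

Lemma ccont_ext (c c' : R -> C) (t : R) :
  (forall u, c u = c' u) -> ccont c t -> ccont c' t.
Proof.
intros E H eps Heps; destruct (H eps Heps) as [d [Hd H']].
exists d; split; [exact Hd|]; intros u Hu; rewrite <- 2!E; auto.
Qed.

Lemma ccont_const (k : C) (t : R) : ccont (fun _ => k) t.
Proof.
intros eps Heps; exists 1; split; [lra|]; intros u _.
replace (k - k)%C with (RtoC 0) by ring; rewrite Cmod_0; exact Heps.
Qed.

Lemma ccont_RtoC (t : R) : ccont RtoC t.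
Proof.
intros eps Heps; exists eps; split; [exact Heps|]; intros u Hu.
rewrite <- RtoC_minus, Cmod_R; exact Hu.
Qed.

Lemma ccont_plus (c d : R -> C) (t : R) :
  ccont c t -> ccont d t -> ccont (fun u => c u + d u)%C t.
Proof.
intros Hc Hd eps Heps.
destruct (Hc (eps / 2)) as [d1 [P1 H1]]; [lra|].
destruct (Hd (eps / 2)) as [d2 [P2 H2]]; [lra|].
exists (Rmin d1 d2); split; [apply Rmin_pos; assumption|]; intros u Hu.
replace (c u + d u - (c t + d t))%C with ((c u - c t) + (d u - d t))%C by ring.
eapply Rle_lt_trans; [apply Cmod_triangle|].
generalize (H1 u (Rlt_le_trans _ _ _ Hu (Rmin_l _ _)))
  (H2 u (Rlt_le_trans _ _ _ Hu (Rmin_r _ _))); lra.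
Qed.

Lemma ccont_mult (c d : R -> C) (t : R) :
  ccont c t -> ccont d t -> ccont (fun u => c u * d u)%C t.
Proof.
intros Hc Hd eps Heps.
(* If both increments are below [e <= 1], the three terms of the product's increment add up to less
   than [e * M]. *)
set (M := 1 + Cmod (c t) + Cmod (d t)).
assert (Mc := Cmod_ge_0 (c t)); assert (Md := Cmod_ge_0 (d t)).
assert (M1 : 1 <= M) by (unfold M; lra).
assert (E0 : 0 < Rmin 1 (eps / (2 * M))).
{ apply Rmin_pos; [lra|]; apply Rdiv_lt_0_compat; lra. }
destruct (Hc _ E0) as [d1 [P1 H1]].
destruct (Hd _ E0) as [d2 [P2 H2]].
exists (Rmin d1 d2); split; [apply Rmin_pos; assumption|]; intros u Hu.
specialize (H1 u (Rlt_le_trans _ _ _ Hu (Rmin_l _ _))).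
specialize (H2 u (Rlt_le_trans _ _ _ Hu (Rmin_r _ _))).
replace (c u * d u - c t * d t)%C with
  ((c u - c t) * (d u - d t) + ((c u - c t) * d t + c t * (d u - d t)))%C by ring.
eapply Rle_lt_trans; [apply Cmod_triangle|].
eapply Rle_lt_trans; [apply Rplus_le_compat_l, Cmod_triangle|].
rewrite !Cmod_mult.
assert (X := Cmod_ge_0 (c u - c t)); assert (Y := Cmod_ge_0 (d u - d t)).
generalize (Rmin_l 1 (eps / (2 * M))) (Rmin_r 1 (eps / (2 * M))).
set (e := Rmin 1 (eps / (2 * M))) in *; intros L1 L2.
assert (L3 : e * M <= eps / 2).
{ replace (eps / 2) with (eps / (2 * M) * M) by (field; lra).
  apply Rmult_le_compat_r; lra. }
unfold M in *; nra.
Qed.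

Lemma rderiv_ccont (c : R -> C) (t : R) (v : C) : rderiv c t v -> ccont c t.
Proof.
intros H eps Heps.
destruct (H 1 Rlt_0_1) as [d [P D]].
assert (V := Cmod_ge_0 v).
exists (Rmin d (eps / (2 + Cmod v))); split.
{ apply Rmin_pos; [exact P|]; apply Rdiv_lt_0_compat; lra. }
intros u Hu.
specialize (D u (Rlt_le_trans _ _ _ Hu (Rmin_l _ _))).
assert (L := Rlt_le_trans _ _ _ Hu (Rmin_r _ _)).
replace (c u - c t)%C with ((c u - c t - v * (u - t)%R) + v * (u - t)%R)%C by ring.
eapply Rle_lt_trans; [apply Cmod_triangle|].
rewrite Cmod_mult, Cmod_R.
apply Rmult_lt_compat_r with (r := 2 + Cmod v) in L; [|lra].
replace (eps / (2 + Cmod v) * (2 + Cmod v)) with eps in L by (field; lra).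
assert (W := Rabs_pos (u - t)); nra.
Qed.

Lemma cderiv_lipschitz_at (f : C -> C) (z l : C) : cderiv f z l ->
  exists d, 0 < d /\ forall w, Cmod (w - z) < d ->
    Cmod (f w - f z) <= (1 + Cmod l) * Cmod (w - z).
Proof.
intros H; destruct (H 1 Rlt_0_1) as [d [P D]].
exists d; split; [exact P|]; intros w Hw; specialize (D w Hw).
replace (f w - f z)%C with ((f w - f z - l * (w - z)) + l * (w - z))%C by ring.
eapply Rle_trans; [apply Cmod_triangle|].
rewrite Cmod_mult; lra.
Qed.

Lemma cderiv_continuous (f : C -> C) (z l : C) : cderiv f z l ->
  forall eps, 0 < eps -> exists d, 0 < d /\
    forall w, Cmod (w - z) < d -> Cmod (f w - f z) < eps.
Proof.
intros H eps Heps; destruct (cderiv_lipschitz_at f z l H) as [d [P D]].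
assert (V := Cmod_ge_0 l).
exists (Rmin d (eps / (1 + Cmod l))); split.
{ apply Rmin_pos; [exact P|]; apply Rdiv_lt_0_compat; lra. }
intros w Hw.
specialize (D w (Rlt_le_trans _ _ _ Hw (Rmin_l _ _))).
assert (L := Rlt_le_trans _ _ _ Hw (Rmin_r _ _)).
apply Rmult_lt_compat_r with (r := 1 + Cmod l) in L; [|lra].
replace (eps / (1 + Cmod l) * (1 + Cmod l)) with eps in L by (field; lra).
lra.
Qed.

Lemma ccont_comp (f : C -> C) (c : R -> C) (t : R) (l : C) :
  cderiv f (c t) l -> ccont c t -> ccont (fun u => f (c u)) t.
Proof.
intros Hf Hc eps Heps.
destruct (cderiv_continuous f _ l Hf eps Heps) as [e [P D]].
destruct (Hc e P) as [d [Q E]].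
exists d; split; [exact Q|]; intros u Hu; apply D, E, Hu.
Qed.

Lemma rderiv_comp (f : C -> C) (c : R -> C) (t : R) (l v : C) :
  cderiv f (c t) l -> rderiv c t v -> rderiv (fun u => f (c u)) t (l * v)%C.
Proof.
intros Hf Hc eps Heps.
assert (L := Cmod_ge_0 l); assert (V := Cmod_ge_0 v).
(* The error is that of [f] at the increment of [c], plus [l] times that of [c]. As [e2 <= 1], the
   increment of [c] is at most [(1 + Cmod v) * Rabs (u - t)], so each part costs at most
   [eps / 2]. *)
set (e1 := eps / (2 * (1 + Cmod v))).
set (e2 := Rmin 1 (eps / (2 * (1 + Cmod l)))).
assert (P1 : 0 < e1) by (apply Rdiv_lt_0_compat; lra).
assert (P2 : 0 < e2).
{ apply Rmin_pos; [lra|apply Rdiv_lt_0_compat; lra]. }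
destruct (Hf e1 P1) as [d1 [Q1 D1]].
destruct (Hc e2 P2) as [d2 [Q2 D2]].
destruct (rderiv_ccont c t v Hc d1 Q1) as [d3 [Q3 D3]].
exists (Rmin d2 d3); split; [apply Rmin_pos; assumption|]; intros u Hu.
specialize (D2 u (Rlt_le_trans _ _ _ Hu (Rmin_l _ _))).
specialize (D3 u (Rlt_le_trans _ _ _ Hu (Rmin_r _ _))).
specialize (D1 _ D3).
replace (f (c u) - f (c t) - l * v * (u - t)%R)%C with
  ((f (c u) - f (c t) - l * (c u - c t)) + l * (c u - c t - v * (u - t)%R))%C by ring.
eapply Rle_trans; [apply Cmod_triangle|]; rewrite Cmod_mult.
assert (W := Rabs_pos (u - t)).
assert (B : Cmod (c u - c t) <= (1 + Cmod v) * Rabs (u - t)).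
{ replace (c u - c t)%C with ((c u - c t - v * (u - t)%R) + v * (u - t)%R)%C by ring.
  eapply Rle_trans; [apply Cmod_triangle|].
  rewrite Cmod_mult, Cmod_R.
  generalize (Rmin_l 1 (eps / (2 * (1 + Cmod l)))); fold e2; nra. }
assert (A1 : e1 * Cmod (c u - c t) <= eps / 2 * Rabs (u - t)).
{ replace (eps / 2) with (e1 * (1 + Cmod v)) by (unfold e1; field; lra).
  rewrite Rmult_assoc; apply Rmult_le_compat_l; lra. }
assert (A2 : Cmod l * e2 <= eps / 2).
{ replace (eps / 2) with ((1 + Cmod l) * (eps / (2 * (1 + Cmod l)))) by (field; lra).
  generalize (Rmin_r 1 (eps / (2 * (1 + Cmod l)))); fold e2; nra. }
assert (A3 : Cmod l * Cmod (c u - c t - v * (u - t)%R) <= Cmod l * (e2 * Rabs (u - t)))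
  by (apply Rmult_le_compat_l; lra).
nra.
Qed.

(** A second-order remainder is what explicit algebra yields, for polynomials, for [1 / (w - a)] and
    for integrals with a parameter; this is the common passage from it to a derivative. *)
Lemma cderiv_quadratic_error (f : C -> C) (z l : C) (d M : R) : 0 < d ->
  (forall w, Cmod (w - z) < d ->
    Cmod (f w - f z - l * (w - z)) <= M * (Cmod (w - z)) ^ 2) ->
  cderiv f z l.
Proof.
intros Pd H eps Heps.
assert (A := Rabs_pos M).
exists (Rmin d (eps / (1 + Rabs M))); split.
{ apply Rmin_pos; [exact Pd|]; apply Rdiv_lt_0_compat; lra. }
intros w Hw.
specialize (H w (Rlt_le_trans _ _ _ Hw (Rmin_l _ _))).
assert (L := Rlt_le_trans _ _ _ Hw (Rmin_r _ _)).
apply Rmult_lt_compat_r with (r := 1 + Rabs M) in L; [|lra].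
replace (eps / (1 + Rabs M) * (1 + Rabs M)) with eps in L by (field; lra).
eapply Rle_trans; [exact H|].
assert (W := Cmod_ge_0 (w - z)).
assert (X := Rle_abs M); simpl.
replace (M * (Cmod (w - z) * (Cmod (w - z) * 1))) with
  (M * Cmod (w - z) * Cmod (w - z)) by ring.
apply Rmult_le_compat_r; nra.
Qed.

Lemma cderiv_ext_loc (f g : C -> C) (z l : C) (d : R) : 0 < d ->
  (forall w, Cmod (w - z) < d -> f w = g w) -> cderiv f z l -> cderiv g z l.
Proof.
intros Pd E H eps Heps; destruct (H eps Heps) as [e [Pe D]].
exists (Rmin d e); split; [apply Rmin_pos; assumption|]; intros w Hw.
rewrite <- (E w (Rlt_le_trans _ _ _ Hw (Rmin_l _ _))).
rewrite <- (E z).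
- apply D, (Rlt_le_trans _ _ _ Hw (Rmin_r _ _)).
- replace (z - z)%C with (RtoC 0) by ring; rewrite Cmod_0; exact Pd.
Qed.

Lemma cderiv_scal (k : C) (f : C -> C) (z l : C) :
  cderiv f z l -> cderiv (fun w => k * f w)%C z (k * l)%C.
Proof.
intros H eps Heps; assert (K := Cmod_ge_0 k).
destruct (H (eps / (1 + Cmod k))) as [d [P D]]; [apply Rdiv_lt_0_compat; lra|].
exists d; split; [exact P|]; intros w Hw; specialize (D w Hw).
replace (k * f w - k * f z - k * l * (w - z))%C with
  (k * (f w - f z - l * (w - z)))%C by ring.
rewrite Cmod_mult.
apply Rle_trans with ((1 + Cmod k) * (eps / (1 + Cmod k) * Cmod (w - z))).
- apply Rmult_le_compat; try apply Cmod_ge_0; lra.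
- right; field; lra.
Qed.

Lemma cderiv_mult (f g : C -> C) (z l m : C) : cderiv f z l -> cderiv g z m ->
  cderiv (fun w => f w * g w)%C z (l * g z + f z * m)%C.
Proof.
intros Hf Hg.
apply is_derive_cderiv.
(* [is_derive_mult] lives over [AbsRing_NormedModule C_AbsRing], whereas [is_derive_cderiv] uses
   [C_NormedModule]. The limit halves agree by conversion; only the linearity halves are proved
   again. *)
assert (X : forall (h : C -> C) (u v : C), cderiv h u v ->
  @is_derive C_AbsRing (AbsRing_NormedModule C_AbsRing) h u v).
{ intros h u v Hh; apply is_derive_cderiv in Hh; destruct Hh as [_ Hh]; split.
  - apply (@is_linear_scal_l C_AbsRing (AbsRing_NormedModule C_AbsRing)).
  - exact Hh. }
destruct (@is_derive_mult C_AbsRing f g z l m (X _ _ _ Hf) (X _ _ _ Hg) Cmult_comm)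
  as [_ H].
split; [apply (@is_linear_scal_l C_AbsRing C_NormedModule)|exact H].
Qed.

Lemma Cmod_sub_neq_0 (z w : C) : 0 < Cmod (z - w) -> (z - w)%C <> 0%C.
Proof. intros H E; rewrite E, Cmod_0 in H; lra. Qed.

Lemma cderiv_inv (a z : C) : z <> a ->
  cderiv (fun w => / (w - a))%C z (- / ((z - a) * (z - a)))%C.
Proof.
intros H.
assert (N : (z - a)%C <> 0%C).
{ intros E; apply H; replace z with ((z - a) + a)%C by ring; rewrite E; ring. }
assert (P : 0 < Cmod (z - a)) by (apply Cmod_gt_0; exact N).
set (m := Cmod (z - a)) in *.
(* The remainder is [(w - z)^2 / ((w - a) (z - a)^2)], and [|w - a| >= m / 2] when
   [|w - z| < m / 2]. *)
apply cderiv_quadratic_error with (d := m / 2) (M := / (m / 2 * m ^ 2)); [lra|].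
intros w Hw.
assert (Q : m / 2 <= Cmod (w - a)).
{ generalize (Cmod_triangle_inv (z - a) (z - w)).
  replace (z - a - (z - w))%C with (w - a)%C by ring.
  rewrite (Cmod_sub_sym z w); fold m; lra. }
assert (Nw : (w - a)%C <> 0%C) by (apply Cmod_sub_neq_0; lra).
replace (/ (w - a) - / (z - a) - - / ((z - a) * (z - a)) * (w - z))%C with
  ((w - z) * (w - z) * / ((w - a) * ((z - a) * (z - a))))%C by (field; auto).
rewrite !Cmod_mult, Cmod_inv, !Cmod_mult by (repeat apply Cmult_neq_0; auto).
fold m.
rewrite Rmult_comm; simpl; rewrite !Rmult_1_r.
apply Rmult_le_compat_r; [apply Rmult_le_pos; apply Cmod_ge_0|].
apply Rinv_le_contravar.
- apply Rmult_lt_0_compat; [lra|nra].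
- apply Rmult_le_compat_r; nra.
Qed.

(** * Integrals of complex functions of a real variable *)

Definition CInt (f : R -> C) (a b : R) : C :=
  @RInt C_R_CompleteNormedModule f a b.

Definition ccont_on (f : R -> C) (a b : R) : Prop :=
  forall t, a <= t <= b -> ccont f t.

Lemma CInt_correct (f : R -> C) (a b : R) : a <= b -> ccont_on f a b ->
  @is_RInt C_R_NormedModule f a b (CInt f a b).
Proof.
intros Hab H; apply (@RInt_correct C_R_CompleteNormedModule).
apply (@ex_RInt_continuous C_R_CompleteNormedModule); intros t.
rewrite Rmin_left, Rmax_right by exact Hab; intros Ht.
apply ccont_continuous, H, Ht.
Qed.

Lemma CInt_unique (f : R -> C) (a b : R) (l : C) :
  @is_RInt C_R_NormedModule f a b l -> CInt f a b = l.
Proof. exact (@is_RInt_unique C_R_CompleteNormedModule f a b l). Qed.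

Lemma CInt_ext (f g : R -> C) (a b : R) : a <= b ->
  (forall t, a <= t <= b -> f t = g t) -> CInt f a b = CInt g a b.
Proof.
intros Hab H; apply (@RInt_ext C_R_CompleteNormedModule).
rewrite Rmin_left, Rmax_right by exact Hab; intros t Ht; apply H; lra.
Qed.

Lemma CInt_plus (f g : R -> C) (a b : R) : a <= b ->
  ccont_on f a b -> ccont_on g a b ->
  CInt (fun t => f t + g t)%C a b = (CInt f a b + CInt g a b)%C.
Proof.
intros Hab Hf Hg; apply CInt_unique.
exact (@is_RInt_plus C_R_NormedModule f g a b _ _
  (CInt_correct f a b Hab Hf) (CInt_correct g a b Hab Hg)).
Qed.

(** The integral is only real-linear by construction, so a complex factor is treated through real
    and imaginary parts. *)
Lemma CInt_scal (k : C) (f : R -> C) (a b : R) : a <= b ->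
  ccont_on f a b -> CInt (fun t => k * f t)%C a b = (k * CInt f a b)%C.
Proof.
intros Hab Hf; apply CInt_unique.
assert (H := CInt_correct f a b Hab Hf).
assert (H1 := @is_RInt_fct_extend_fst R_NormedModule R_NormedModule f a b _ H).
assert (H2 := @is_RInt_fct_extend_snd R_NormedModule R_NormedModule f a b _ H).
destruct k as [x y].
apply (@is_RInt_fct_extend_pair R_NormedModule R_NormedModule); simpl.
- exact (@is_RInt_minus R_NormedModule _ _ a b _ _
    (@is_RInt_scal R_NormedModule _ a b x _ H1)
    (@is_RInt_scal R_NormedModule _ a b y _ H2)).
- exact (@is_RInt_plus R_NormedModule _ _ a b _ _
    (@is_RInt_scal R_NormedModule _ a b x _ H2)
    (@is_RInt_scal R_NormedModule _ a b y _ H1)).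
Qed.

Lemma ccont_scal (k : C) (f : R -> C) (t : R) :
  ccont f t -> ccont (fun u => k * f u)%C t.
Proof. intros H; apply ccont_mult; [apply ccont_const|exact H]. Qed.

Lemma ccont_minus (f g : R -> C) (t : R) :
  ccont f t -> ccont g t -> ccont (fun u => f u - g u)%C t.
Proof.
intros Hf Hg; apply (ccont_ext (fun u => f u + (- (1)) * g u)%C).
- intros u; ring.
- apply ccont_plus; [exact Hf|apply ccont_scal, Hg].
Qed.

Lemma CInt_minus (f g : R -> C) (a b : R) : a <= b ->
  ccont_on f a b -> ccont_on g a b ->
  CInt (fun t => f t - g t)%C a b = (CInt f a b - CInt g a b)%C.
Proof.
intros Hab Hf Hg; apply CInt_unique.
exact (@is_RInt_minus C_R_NormedModule f g a b _ _
  (CInt_correct f a b Hab Hf) (CInt_correct g a b Hab Hg)).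
Qed.

Lemma CInt_const (k : C) (a b : R) : CInt (fun _ => k) a b = ((b - a)%R * k)%C.
Proof.
rewrite <- scal_C_R; exact (@RInt_const C_R_CompleteNormedModule a b k).
Qed.

Lemma CInt_Chasles (f : R -> C) (a b c : R) : a <= b -> b <= c ->
  ccont_on f a c -> (CInt f a b + CInt f b c)%C = CInt f a c.
Proof.
intros Hab Hbc H; symmetry; apply CInt_unique.
apply (@is_RInt_Chasles C_R_NormedModule f a b c);
  apply CInt_correct; try assumption; intros t Ht; apply H; lra.
Qed.

Lemma CInt_bound (f : R -> C) (a b M : R) : a <= b -> ccont_on f a b ->
  (forall t, a <= t <= b -> Cmod (f t) <= M) ->
  Cmod (CInt f a b) <= (b - a) * M.
Proof.
intros Hab H HM; rewrite <- norm_C_R.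
apply (@norm_RInt_le_const C_R_NormedModule f a b _ M Hab).
- intros t Ht; rewrite norm_C_R; apply HM, Ht.
- apply CInt_correct; assumption.
Qed.

Lemma CInt_FTC (f df : R -> C) (a b : R) : a <= b ->
  (forall t, a <= t <= b -> rderiv f t (df t)) -> ccont_on df a b ->
  CInt df a b = (f b - f a)%C.
Proof.
intros Hab Hf Hdf; apply CInt_unique.
apply (@is_RInt_derive C_R_CompleteNormedModule);
  rewrite Rmin_left, Rmax_right by exact Hab; intros t Ht.
- apply rderiv_is_derive, Hf, Ht.
- apply ccont_continuous, Hdf, Ht.
Qed.

Lemma ccont_bounded (f : R -> C) (a b : R) : ccont_on f a b ->
  exists B, 0 < B /\ forall t, a <= t <= b -> Cmod (f t) <= B.
Proof.
intros H.
destruct (@bounded_continuity R_AbsRing C_R_NormedModule f a b) as [B HB].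
- intros t Ht; exact (ccont_continuous f t (H t Ht)).
- exists (Rmax 1 B); split.
  + apply Rlt_le_trans with (2 := Rmax_l 1 B); lra.
  + intros t Ht; eapply Rle_trans; [|apply Rmax_r].
    rewrite <- norm_C_R; left; apply HB, Ht.
Qed.

(** The mean value inequality, obtained by integrating the derivative, since the mean value theorem
    fails for complex values. *)
Lemma rderiv_lipschitz (c d : R -> C) (a b B : R) :
  (forall t, a <= t <= b -> rderiv c t (d t)) -> ccont_on d a b ->
  (forall t, a <= t <= b -> Cmod (d t) <= B) ->
  forall u v, a <= u <= b -> a <= v <= b -> Cmod (c v - c u) <= B * Rabs (v - u).
Proof.
intros Hc Hd HB.
assert (W : forall u v, a <= u <= b -> a <= v <= b -> u <= v ->
  Cmod (c v - c u) <= B * Rabs (v - u)).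
{ intros u v Hu Hv Huv.
  rewrite <- (CInt_FTC c d u v Huv).
  - rewrite Rabs_right by lra; rewrite Rmult_comm.
    apply CInt_bound; [exact Huv| |]; intros t Ht; [apply Hd|apply HB]; lra.
  - intros t Ht; apply Hc; lra.
  - intros t Ht; apply Hd; lra. }
intros u v Hu Hv; destruct (Rle_dec u v).
- apply W; assumption.
- rewrite Cmod_sub_sym, Rabs_minus_sym; apply W; try assumption; lra.
Qed.

(* Cousin's lemma for dyadic rectangles: [P k x y] speaks about the rectangle of
   sides [W / 2 ^ k] and [V / 2 ^ k] with lower left corner [(x, y)]. *)
Lemma dyadic_rectangle_induction (P : nat -> R -> R -> Prop) (x0 y0 W V : R) :
  0 <= W -> 0 <= V ->
  (forall k x y, x0 <= x -> x + W / 2 ^ k <= x0 + W ->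
    y0 <= y -> y + V / 2 ^ k <= y0 + V ->
    P (S k) x y -> P (S k) (x + W / 2 ^ S k) y ->
    P (S k) x (y + V / 2 ^ S k) -> P (S k) (x + W / 2 ^ S k) (y + V / 2 ^ S k) ->
    P k x y) ->
  (forall X Y, x0 <= X <= x0 + W -> y0 <= Y <= y0 + V ->
    exists delta, 0 < delta /\ forall k x y,
      x0 <= x -> x + W / 2 ^ k <= x0 + W -> y0 <= y -> y + V / 2 ^ k <= y0 + V ->
      x <= X <= x + W / 2 ^ k -> y <= Y <= y + V / 2 ^ k ->
      (W + V) / 2 ^ k < delta -> P k x y) ->
  P O x0 y0.
Proof.
intros HW HV Hsub Hloc; apply NNPP; intros Hn.
assert (Hhalf : forall A k, A / 2 ^ k = A / 2 ^ S k + A / 2 ^ S k).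
{ intros A k; simpl; field; apply pow_nonzero; lra. }
assert (Hpos : forall A k, 0 <= A -> 0 <= A / 2 ^ k).
{ intros A k HA; apply Rmult_le_pos; [exact HA|].
  left; apply Rinv_0_lt_compat, pow_lt; lra. }
set (bad := fun k (q : R * R) => x0 <= fst q /\ fst q + W / 2 ^ k <= x0 + W /\
  y0 <= snd q /\ snd q + V / 2 ^ k <= y0 + V /\ ~ P k (fst q) (snd q)).
set (child := fun k (q r : R * R) =>
  (fst r = fst q \/ fst r = fst q + W / 2 ^ S k) /\
  (snd r = snd q \/ snd r = snd q + V / 2 ^ S k)).
(* The implication sits under the existential so that choice gives a total function [next]. *)
assert (Hstep : forall k q, exists r, bad k q -> bad (S k) r /\ child k q r).
{ intros k [x y].
  destruct (classic (bad k (x, y))) as [B|B]; [|exists (x, y); tauto].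
  destruct B as [B1 [B2 [B3 [B4 B5]]]]; cbn [fst snd] in B1, B2, B3, B4, B5.
  assert (B2' := B2); assert (B4' := B4); rewrite Hhalf in B2', B4'.
  assert (H3 := Hpos W (S k) HW); assert (H4 := Hpos V (S k) HV).
  (* A quarter on which [P] fails would be a bad child; hence [P] holds on all four quarters, and
     [Hsub] contradicts the badness of the parent. *)
  apply NNPP; intros N; apply B5, Hsub; try assumption; clear B2 B4; apply NNPP; intros Q; apply N;
    clear - B1 B3 B2' B4' H3 H4 Q;
    [exists (x, y)|exists (x + W / 2 ^ S k, y)|exists (x, y + V / 2 ^ S k)|
     exists (x + W / 2 ^ S k, y + V / 2 ^ S k)];
    intros _; unfold bad, child; cbn [fst snd];
    repeat match goal with |- _ /\ _ => split end;
    first [exact Q | left; reflexivity | right; reflexivity | lra]. }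
set (next := fun k q => proj1_sig (constructive_indefinite_description _ (Hstep k q))).
assert (Hnext : forall k q, bad k q -> bad (S k) (next k q) /\ child k q (next k q)).
{ intros k q; unfold next.
  exact (proj2_sig (constructive_indefinite_description _ (Hstep k q))). }
set (q := fix q k := match k with O => (x0, y0) | S k => next k (q k) end).
assert (Hbad : forall k, bad k (q k)).
{ induction k as [|k IH].
  - unfold bad; simpl; repeat split; try lra; exact Hn.
  - apply (proj1 (Hnext k (q k) IH)). }
assert (Hchild : forall k, child k (q k) (q (S k))).
{ intros k; apply (proj2 (Hnext k (q k) (Hbad k))). }
(* Nested intervals in one coordinate: the left ends [u k] increase and the right ends decrease, so
   the limit of the left ends lies in every interval. *)
assert (Hlim : forall (u : nat -> R) (A B : R), 0 <= A ->
  (forall k, u (S k) = u k \/ u (S k) = u k + A / 2 ^ S k) ->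
  (forall k, u k <= B) -> exists X, forall k, u k <= X <= u k + A / 2 ^ k).
{ intros u A B HA Hu HB.
  assert (I : forall k, u k <= u (S k)).
  { intros k; generalize (Hpos A (S k) HA); destruct (Hu k); lra. }
  assert (D : forall k, u (S k) + A / 2 ^ S k <= u k + A / 2 ^ k).
  { intros k; rewrite (Hhalf A k); generalize (Hpos A (S k) HA); destruct (Hu k); lra. }
  destruct (ex_finite_lim_seq_incr u B I HB) as [X HX].
  exists X; intros k; split.
  - exact (is_lim_seq_incr_compare u X HX I k).
  - assert (E : forall n, (k <= n)%nat -> u n + A / 2 ^ n <= u k + A / 2 ^ k).
    { induction 1 as [|n Hle IH]; [apply Rle_refl|exact (Rle_trans _ _ _ (D n) IH)]. }
    apply (is_lim_seq_le_loc u (fun _ => u k + A / 2 ^ k) X (u k + A / 2 ^ k));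
      [|exact HX|apply is_lim_seq_const].
    exists k; intros n Hkn; generalize (E n Hkn) (Hpos A n HA); lra. }
destruct (Hlim (fun k => fst (q k)) W (x0 + W) HW) as [X HX].
{ intros k; apply Hchild. }
{ intros k; destruct (Hbad k) as [_ [B _]]; generalize (Hpos W k HW); lra. }
destruct (Hlim (fun k => snd (q k)) V (y0 + V) HV) as [Y HY].
{ intros k; apply Hchild. }
{ intros k; destruct (Hbad k) as [_ [_ [_ [B _]]]]; generalize (Hpos V k HV); lra. }
assert (E0 : forall A, A / 2 ^ 0 = A) by (intros A; simpl; field).
destruct (Hloc X Y) as [delta [Pd HD]].
{ generalize (HX O); rewrite E0; intros X0; exact X0. }
{ generalize (HY O); rewrite E0; intros Y0; exact Y0. }
(* At depth [N] the rectangle is finer than [delta]. The summand 1 keeps the denominator positive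
   when [W + V = 0]. *)
destruct (pow_lt_1_zero (/ 2)) with (y := delta / (1 + (W + V))) as [N HN].
{ rewrite Rabs_right; lra. }
{ apply Rdiv_lt_0_compat; lra. }
specialize (HN N (le_n N)).
rewrite Rabs_right in HN by (left; apply pow_lt; lra).
destruct (Hbad N) as [B1 [B2 [B3 [B4 B5]]]].
apply B5, HD; try assumption; [apply HX|apply HY|].
unfold Rdiv; rewrite <- pow_inv.
assert (Q : 0 < (/ 2) ^ N) by (apply pow_lt; lra).
apply Rmult_lt_compat_r with (r := 1 + (W + V)) in HN; [|lra].
replace (delta / (1 + (W + V)) * (1 + (W + V))) with delta in HN by (field; lra).
nra.
Qed.

(** * Goursat's theorem on cones *)

(* The three pieces below make up the integral of [h] along the image of the
   boundary of [[s0, s1] x [t0, t1]] under [(s, t) -> p + s c(t)], the cone with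
   apex [p] over the curve [p + c]; [d] is the derivative of [c]. *)
Definition arc_int (h : C -> C) (p : C) (c d : R -> C) (s a b : R) : C :=
  CInt (fun t => h (p + s * c t) * (s * d t))%C a b.

Definition ray_int (h : C -> C) (p : C) (c : R -> C) (t a b : R) : C :=
  CInt (fun s => h (p + s * c t) * c t)%C a b.

Definition cone_int (h : C -> C) (p : C) (c d : R -> C) (s0 s1 t0 t1 : R) : C :=
  (arc_int h p c d s1 t0 t1 - arc_int h p c d s0 t0 t1
   - ray_int h p c t1 s0 s1 + ray_int h p c t0 s0 s1)%C.

Lemma rderiv_affine (p k : C) (c : R -> C) (t : R) (v : C) :
  rderiv c t v -> rderiv (fun u => p + k * c u)%C t (k * v)%C.
Proof.
intros H eps Heps; assert (K := Cmod_ge_0 k).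
destruct (H (eps / (1 + Cmod k))) as [d [P D]]; [apply Rdiv_lt_0_compat; lra|].
exists d; split; [exact P|]; intros u Hu; specialize (D u Hu).
replace (p + k * c u - (p + k * c t) - k * v * (u - t)%R)%C with
  (k * (c u - c t - v * (u - t)%R))%C by ring.
rewrite Cmod_mult.
apply Rle_trans with ((1 + Cmod k) * (eps / (1 + Cmod k) * Rabs (u - t))).
- apply Rmult_le_compat; try apply Cmod_ge_0; lra.
- right; field; lra.
Qed.

Lemma rderiv_line (p k : C) (s : R) : rderiv (fun u => p + RtoC u * k)%C s k.
Proof.
intros eps Heps; exists 1; split; [lra|]; intros u _.
replace (p + u * k - (p + s * k) - k * (u - s)%R)%C with (RtoC 0)
  by (rewrite RtoC_minus; ring).
rewrite Cmod_0; apply Rmult_le_pos; [lra|apply Rabs_pos].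
Qed.

Lemma arc_ccont (h : C -> C) (p : C) (c d : R -> C) (s t : R) :
  (exists l, cderiv h (p + s * c t)%C l) -> ccont c t -> ccont d t ->
  ccont (fun t => h (p + s * c t) * (s * d t))%C t.
Proof.
intros [l Hl] Hc Hd; apply ccont_mult; [|apply ccont_scal, Hd].
apply (ccont_comp h (fun t => p + s * c t)%C t l Hl).
apply ccont_plus; [apply ccont_const|apply ccont_scal, Hc].
Qed.

Lemma ray_ccont (h : C -> C) (p : C) (c : R -> C) (s t : R) :
  (exists l, cderiv h (p + s * c t)%C l) ->
  ccont (fun s => h (p + s * c t) * c t)%C s.
Proof.
intros [l Hl]; apply ccont_mult; [|apply ccont_const].
apply (ccont_comp h (fun s => p + RtoC s * c t)%C s l Hl).
apply (rderiv_ccont _ _ (c t)), rderiv_line.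
Qed.

(** The inner pieces, at [s1] and at [t1], are each traversed twice in opposite directions and
    cancel. *)
Lemma cone_int_split (h : C -> C) (p : C) (c d : R -> C) (s0 s1 s2 t0 t1 t2 : R) :
  s0 <= s1 -> s1 <= s2 -> t0 <= t1 -> t1 <= t2 ->
  ccont_on c t0 t2 -> ccont_on d t0 t2 ->
  (forall s t, s0 <= s <= s2 -> t0 <= t <= t2 ->
    exists l, cderiv h (p + s * c t)%C l) ->
  cone_int h p c d s0 s2 t0 t2 =
  (cone_int h p c d s0 s1 t0 t1 + cone_int h p c d s1 s2 t0 t1
   + cone_int h p c d s0 s1 t1 t2 + cone_int h p c d s1 s2 t1 t2)%C.
Proof.
intros S01 S12 T01 T12 Hc Hd Hh; unfold cone_int.
assert (EA : forall s, s0 <= s <= s2 -> arc_int h p c d s t0 t2 =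
  (arc_int h p c d s t0 t1 + arc_int h p c d s t1 t2)%C).
{ intros s Hs; symmetry; apply CInt_Chasles; try assumption.
  intros t Ht; apply arc_ccont; auto. }
assert (ER : forall t, t0 <= t <= t2 -> ray_int h p c t s0 s2 =
  (ray_int h p c t s0 s1 + ray_int h p c t s1 s2)%C).
{ intros t Ht; symmetry; apply CInt_Chasles; try assumption.
  intros s Hs; apply ray_ccont; auto. }
rewrite !EA, !ER by lra; ring.
Qed.

Lemma cderiv_quadratic (a b z : C) :
  cderiv (fun w => a * w + b / 2 * (w * w))%C z (a + b * z)%C.
Proof.
apply cderiv_quadratic_error with (d := 1) (M := Cmod (b / 2)); [lra|].
intros w _.
assert (N2 : RtoC 2 <> 0%C) by (intros E; apply RtoC_inj in E; lra).
replace (a * w + b / 2 * (w * w) - (a * z + b / 2 * (z * z)) -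
  (a + b * z) * (w - z))%C with (b / 2 * ((w - z) * (w - z)))%C by (field; exact N2).
rewrite !Cmod_mult; right; ring.
Qed.

Lemma cderiv_affine (a b z : C) : cderiv (fun w => a + b * w)%C z b.
Proof.
apply cderiv_quadratic_error with (d := 1) (M := 0); [lra|]; intros w _.
replace (a + b * w - (a + b * z) - b * (w - z))%C with (RtoC 0) by ring.
rewrite Cmod_0; lra.
Qed.

(** An affine function has the explicit primitive [P]; each side contributes a difference of values
    of [P] at two corners, and these telescope around the boundary. *)
Lemma cone_int_affine (a b p : C) (c d : R -> C) (s0 s1 t0 t1 : R) :
  s0 <= s1 -> t0 <= t1 ->
  (forall t, t0 <= t <= t1 -> rderiv c t (d t)) -> ccont_on d t0 t1 ->
  cone_int (fun z => a + b * z)%C p c d s0 s1 t0 t1 = 0%C.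
Proof.
intros S T Hc Hd; unfold cone_int.
set (P := fun w => (a * w + b / 2 * (w * w))%C).
assert (HA := cderiv_affine a b).
assert (EA : forall s, arc_int (fun z => a + b * z)%C p c d s t0 t1 =
  (P (p + s * c t1) - P (p + s * c t0))%C).
{ intros s; apply (CInt_FTC (fun t => P (p + s * c t)%C)); [exact T| |].
  - intros t Ht.
    apply (rderiv_comp P (fun t => p + s * c t)%C);
      [apply cderiv_quadratic|apply rderiv_affine, Hc, Ht].
  - intros t Ht; apply (arc_ccont (fun z => a + b * z)%C);
      [eauto|apply (rderiv_ccont _ _ (d t)), Hc, Ht|apply Hd, Ht]. }
assert (ER : forall t, ray_int (fun z => a + b * z)%C p c t s0 s1 =
  (P (p + s1 * c t) - P (p + s0 * c t))%C).
{ intros t; apply (CInt_FTC (fun s => P (p + RtoC s * c t)%C)); [exact S| |].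
  - intros s _.
    apply (rderiv_comp P (fun s => p + RtoC s * c t)%C);
      [apply cderiv_quadratic|apply rderiv_line].
  - intros s Hs; apply (ray_ccont (fun z => a + b * z)%C); eauto. }
rewrite !EA, !ER; ring.
Qed.

Lemma cderiv_sub_affine (h : C -> C) (a b z l : C) : cderiv h z l ->
  cderiv (fun w => h w - (a + b * w))%C z (l - b)%C.
Proof.
intros H eps Heps; destruct (H eps Heps) as [e [P D]].
exists e; split; [exact P|]; intros w Hw; specialize (D w Hw).
replace (h w - (a + b * w) - (h z - (a + b * z)) - (l - b) * (w - z))%C with
  (h w - h z - l * (w - z))%C by ring; exact D.
Qed.

(** Serves to replace [h] by its first-order Taylor remainder at a point, which is small near that
    point. *)
Lemma cone_int_sub_affine (h : C -> C) (a b p : C) (c d : R -> C) (s0 s1 t0 t1 : R) :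
  s0 <= s1 -> t0 <= t1 ->
  (forall t, t0 <= t <= t1 -> rderiv c t (d t)) -> ccont_on d t0 t1 ->
  (forall s t, s0 <= s <= s1 -> t0 <= t <= t1 ->
    exists l, cderiv h (p + s * c t)%C l) ->
  cone_int h p c d s0 s1 t0 t1 =
  cone_int (fun z => h z - (a + b * z))%C p c d s0 s1 t0 t1.
Proof.
intros S T Hc Hd Hh.
assert (HA : forall z, exists l, cderiv (fun z => a + b * z)%C z l).
{ intros z; exists b; apply cderiv_affine. }
assert (Hcc : ccont_on c t0 t1).
{ intros t Ht; apply (rderiv_ccont _ _ (d t)), Hc, Ht. }
rewrite <- (Cplus_0_r (cone_int _ p c d s0 s1 t0 t1)) at 1.
rewrite <- (Copp_0), <- (cone_int_affine a b p c d s0 s1 t0 t1 S T Hc Hd).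
assert (EA : forall s, s0 <= s <= s1 ->
  arc_int (fun z => h z - (a + b * z))%C p c d s t0 t1 =
  (arc_int h p c d s t0 t1 - arc_int (fun z => a + b * z)%C p c d s t0 t1)%C).
{ intros s Hs; unfold arc_int; rewrite <- CInt_minus; try exact T.
  - apply CInt_ext; [exact T|]; intros t _; ring.
  - intros t Ht; apply arc_ccont; auto.
  - intros t Ht; apply (arc_ccont (fun z => a + b * z)%C); auto. }
assert (ER : forall t, t0 <= t <= t1 ->
  ray_int (fun z => h z - (a + b * z))%C p c t s0 s1 =
  (ray_int h p c t s0 s1 - ray_int (fun z => a + b * z)%C p c t s0 s1)%C).
{ intros t Ht; unfold ray_int; rewrite <- CInt_minus; try exact S.
  - apply CInt_ext; [exact S|]; intros s _; ring.
  - intros s Hs; apply ray_ccont; auto.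
  - intros s Hs; apply (ray_ccont (fun z => a + b * z)%C); auto. }
unfold cone_int; rewrite !EA, !ER by lra; ring.
Qed.

(** The arc integrands are at most [M * (B * B)] and the ray integrands at most [M * B], which
    [1 <= B] absorbs into the same bound; there are two arcs and two rays. *)
Lemma cone_int_bound (h : C -> C) (p : C) (c d : R -> C) (s0 s1 t0 t1 B M : R) :
  s0 <= s1 -> t0 <= t1 -> 1 <= B -> 0 <= M ->
  ccont_on c t0 t1 -> ccont_on d t0 t1 ->
  (forall s, s0 <= s <= s1 -> Rabs s <= B) ->
  (forall t, t0 <= t <= t1 -> Cmod (c t) <= B /\ Cmod (d t) <= B) ->
  (forall s t, s0 <= s <= s1 -> t0 <= t <= t1 ->
    (exists l, cderiv h (p + s * c t)%C l) /\ Cmod (h (p + s * c t)%C) <= M) ->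
  Cmod (cone_int h p c d s0 s1 t0 t1) <= 2 * (M * B ^ 2) * ((s1 - s0) + (t1 - t0)).
Proof.
intros S T HB HM Hc Hd Hs Ht Hh.
assert (EA : forall s, s0 <= s <= s1 ->
  Cmod (arc_int h p c d s t0 t1) <= (t1 - t0) * (M * B ^ 2)).
{ intros s Hs'; apply CInt_bound; [exact T| |].
  - intros t Ht'; apply arc_ccont; auto; apply Hh; assumption.
  - intros t Ht'; rewrite !Cmod_mult, Cmod_R.
    replace (M * B ^ 2) with (M * (B * B)) by ring.
    apply Rmult_le_compat; [apply Cmod_ge_0| |apply Hh; assumption|].
    + apply Rmult_le_pos; [apply Rabs_pos|apply Cmod_ge_0].
    + apply Rmult_le_compat; [apply Rabs_pos|apply Cmod_ge_0|auto|apply Ht; auto]. }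
assert (ER : forall t, t0 <= t <= t1 ->
  Cmod (ray_int h p c t s0 s1) <= (s1 - s0) * (M * B ^ 2)).
{ intros t Ht'; apply CInt_bound; [exact S| |].
  - intros s Hs'; apply ray_ccont; auto; apply Hh; assumption.
  - intros s Hs'; rewrite !Cmod_mult.
    replace (M * B ^ 2) with (M * (B * B)) by ring.
    apply Rmult_le_compat; [apply Cmod_ge_0|apply Cmod_ge_0|apply Hh; assumption|].
    destruct (Ht t Ht'); nra. }
unfold cone_int.
eapply Rle_trans; [apply Cmod_triangle|].
eapply Rle_trans; [apply Rplus_le_compat_r, Cmod_sub_triangle|].
eapply Rle_trans; [apply Rplus_le_compat_r, Rplus_le_compat_r, Cmod_sub_triangle|].
generalize (EA s0 ltac:(lra)) (EA s1 ltac:(lra)) (ER t0 ltac:(lra)) (ER t1 ltac:(lra)).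
lra.
Qed.

(** The bound [eps * 4^(-k)] for rectangles of depth [k] is additive under quartering, and it holds
    on small rectangles because the Taylor remainder and the perimeter both scale like [2^(-k)]. *)
Lemma cone_goursat (h : C -> C) (p : C) (c d : R -> C) (s0 s1 t0 t1 : R) :
  s0 <= s1 -> t0 <= t1 ->
  (forall t, t0 <= t <= t1 -> rderiv c t (d t)) -> ccont_on d t0 t1 ->
  (forall s t, s0 <= s <= s1 -> t0 <= t <= t1 ->
    exists l, cderiv h (p + s * c t)%C l) ->
  cone_int h p c d s0 s1 t0 t1 = 0%C.
Proof.
intros Hs01 Ht01 Hc Hd Hh.
assert (Hcc : ccont_on c t0 t1).
{ intros t Ht; apply (rderiv_ccont _ _ (d t)), Hc, Ht. }
destruct (ccont_bounded c t0 t1 Hcc) as [Bc [Pc HBc]].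
destruct (ccont_bounded d t0 t1 Hd) as [Bd [Pd HBd]].
set (B := 1 + Bc + Bd + Rabs s0 + Rabs s1).
assert (A0 := Rabs_pos s0); assert (A1 := Rabs_pos s1).
assert (HB : 1 <= B) by (unfold B; lra).
assert (Bs : forall s, s0 <= s <= s1 -> Rabs s <= B).
{ intros s Hs; apply Rabs_le.
  generalize (Rle_abs s1) (Rle_abs (- s0)); rewrite Rabs_Ropp; unfold B; lra. }
assert (Bt : forall t, t0 <= t <= t1 -> Cmod (c t) <= B /\ Cmod (d t) <= B).
{ intros t Ht; generalize (HBc t Ht) (HBd t Ht); unfold B; lra. }
set (W := s1 - s0); set (V := t1 - t0).
assert (Small : forall eps, 0 < eps -> Cmod (cone_int h p c d s0 s1 t0 t1) <= eps).
{ intros eps Heps.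
  assert (G : Cmod (cone_int h p c d s0 (s0 + W / 2 ^ 0) t0 (t0 + V / 2 ^ 0))
      <= eps * (/ 2 ^ 0 * / 2 ^ 0)).
  2:{ replace (s0 + W / 2 ^ 0) with s1 in G by (unfold W; simpl; field).
      replace (t0 + V / 2 ^ 0) with t1 in G by (unfold V; simpl; field).
      simpl in G; lra. }
  apply (dyadic_rectangle_induction (fun k x y =>
    Cmod (cone_int h p c d x (x + W / 2 ^ k) y (y + V / 2 ^ k))
      <= eps * (/ 2 ^ k * / 2 ^ k)) s0 t0 W V).
  - unfold W; lra.
  - unfold V; lra.
  - intros k x y X1 X2 Y1 Y2.
    assert (Q : 0 < / 2 ^ S k) by (apply Rinv_0_lt_compat, pow_lt; lra).
    assert (E : / 2 ^ k = 2 * / 2 ^ S k)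
      by (simpl; field; apply pow_nonzero; lra).
    (* With [q = 2^(-(k+1))] the target [eps * (2 q)^2] is exactly the sum of the four bounds
       [eps * q^2]. *)
    unfold Rdiv in *; rewrite E in *; set (q := / 2 ^ S k) in *; clearbody q; clear E.
    assert (PW : 0 <= W * q) by (apply Rmult_le_pos; [unfold W|]; lra).
    assert (PV : 0 <= V * q) by (apply Rmult_le_pos; [unfold V|]; lra).
    intros H1 H2 H3 H4.
    rewrite (cone_int_split h p c d x (x + W * q) (x + W * (2 * q))
      y (y + V * q) (y + V * (2 * q))); try lra.
    + replace (x + W * (2 * q)) with (x + W * q + W * q) by ring.
      replace (y + V * (2 * q)) with (y + V * q + V * q) by ring.
      eapply Rle_trans; [apply Cmod_triangle|].
      eapply Rle_trans; [apply Rplus_le_compat_r, Cmod_triangle|].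
      eapply Rle_trans; [apply Rplus_le_compat_r, Rplus_le_compat_r, Cmod_triangle|].
      lra.
    + intros t Ht; apply Hcc; unfold V in *; lra.
    + intros t Ht; apply Hd; unfold V in *; lra.
    + intros s t Hs Ht; apply Hh; unfold W, V in *; lra.
  - intros X Y HX HY.
    assert (HX' : s0 <= X <= s1) by (unfold W in HX; lra).
    assert (HY' : t0 <= Y <= t1) by (unfold V in HY; lra).
    destruct (Hh X Y HX' HY') as [l Hl].
    set (z0 := (p + X * c Y)%C) in *.
    (* On a small rectangle [cone_int_bound] will give [eta * 2 * B^4 * (w + v)^2], where
       [w + v = (W + V) / 2^k]; this choice of [eta] brings it below [eps * 4^(-k)]. *)
    set (eta := eps / (1 + 2 * B ^ 4 * (W + V) ^ 2)).
    assert (Den : 0 < 1 + 2 * B ^ 4 * (W + V) ^ 2).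
    { assert (0 <= B ^ 4) by (apply pow_le; lra).
      generalize (pow2_ge_0 (W + V)); nra. }
    assert (Peta : 0 < eta) by (apply Rdiv_lt_0_compat; assumption).
    destruct (Hl eta Peta) as [delta [Pdelta Hdelta]].
    exists (delta / B ^ 2); split.
    { apply Rdiv_lt_0_compat; [exact Pdelta|apply pow_lt; lra]. }
    intros k x y X1 X2 Y1 Y2 HX2 HY2 Hk.
    set (w := W / 2 ^ k) in *; set (v := V / 2 ^ k) in *.
    assert (Ewv : (W + V) / 2 ^ k = w + v) by (unfold w, v, Rdiv; ring).
    clearbody w v.
    rewrite Ewv in Hk.
    apply Rmult_lt_compat_r with (r := B ^ 2) in Hk; [|apply pow_lt; lra].
    replace (delta / B ^ 2 * B ^ 2) with delta in Hk by (field; lra).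
    (* The parametrisation is Lipschitz with constant [B^2], so by the choice [delta / B^2] the
       whole image lies within [delta] of [z0]. *)
    assert (Near : forall s t, x <= s <= x + w -> y <= t <= y + v ->
      Cmod ((p + s * c t) - z0) <= B ^ 2 * (w + v)).
    { intros s t Hs Ht; unfold z0.
      replace (p + s * c t - (p + X * c Y))%C with
        ((s - X)%R * c t + X * (c t - c Y))%C by (rewrite RtoC_minus; ring).
      eapply Rle_trans; [apply Cmod_triangle|]; rewrite !Cmod_mult, !Cmod_R.
      assert (Ht' : t0 <= t <= t1) by (unfold V in *; lra).
      assert (L := rderiv_lipschitz c d t0 t1 B Hc Hd (fun t Ht => proj2 (Bt t Ht))
        Y t HY' Ht').
      assert (RX : Rabs (s - X) <= w) by (apply Rabs_le; lra).
      assert (RY : Rabs (t - Y) <= v) by (apply Rabs_le; lra).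
      destruct (Bt t Ht') as [Bt1 _].
      assert (BX := Bs X HX').
      assert (P1 := Rabs_pos (s - X)); assert (P2 := Rabs_pos (t - Y)).
      apply Rle_trans with (w * B + B * (B * v)).
      2:{ assert (Q : 0 <= (w * B) * (B - 1)) by (repeat apply Rmult_le_pos; lra); nra. }
      apply Rplus_le_compat.
      - apply Rmult_le_compat; auto; apply Cmod_ge_0.
      - apply Rmult_le_compat; [apply Rabs_pos|apply Cmod_ge_0|exact BX|].
        eapply Rle_trans; [exact L|]; apply Rmult_le_compat_l; lra. }
    assert (Pw : 0 <= w) by lra; assert (Pv : 0 <= v) by lra.
    rewrite (cone_int_sub_affine h (h z0 - l * z0)%C l); try lra.
    + eapply Rle_trans.
      * apply (cone_int_bound _ p c d _ _ _ _ B (eta * (B ^ 2 * (w + v)))); try lra.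
        -- apply Rmult_le_pos; [lra|]; apply Rmult_le_pos; [apply pow_le|]; lra.
        -- intros t Ht; apply Hcc; unfold V in *; lra.
        -- intros t Ht; apply Hd; unfold V in *; lra.
        -- intros s Hs; apply Bs; unfold W in *; lra.
        -- intros t Ht; apply Bt; unfold V in *; lra.
        -- intros s t Hs Ht; split.
           ++ destruct (Hh s t) as [m Hm]; [unfold W in *; lra|unfold V in *; lra|].
              exists (m - l)%C; apply cderiv_sub_affine, Hm.
           ++ specialize (Near s t Hs Ht).
              replace (h (p + s * c t) - (h z0 - l * z0 + l * (p + s * c t)))%C with
                (h (p + s * c t) - h z0 - l * ((p + s * c t) - z0))%C by ring.
              eapply Rle_trans; [apply Hdelta; lra|].
              apply Rmult_le_compat_l; lra.
      * replace (x + w - x) with w by ring; replace (y + v - y) with v by ring.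
        replace (eps * (/ 2 ^ k * / 2 ^ k)) with
          (eta * ((1 + 2 * B ^ 4 * (W + V) ^ 2) * (/ 2 ^ k * / 2 ^ k)))
          by (unfold eta; field; split; [apply pow_nonzero|]; lra).
        replace (2 * (eta * (B ^ 2 * (w + v)) * B ^ 2) * (w + v)) with
          (eta * (2 * B ^ 4 * (w + v) ^ 2)) by ring.
        apply Rmult_le_compat_l; [lra|].
        rewrite <- Ewv; unfold Rdiv.
        generalize (pow2_ge_0 (/ 2 ^ k)); nra.
    + intros t Ht; apply Hc; unfold V in *; lra.
    + intros t Ht; apply Hd; unfold V in *; lra.
    + intros s t Hs Ht; apply Hh; unfold W, V in *; lra. }
apply Cmod_eq_0, Rle_antisym; [|apply Cmod_ge_0].
apply Rnot_lt_le; intros N.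
specialize (Small (Cmod (cone_int h p c d s0 s1 t0 t1) / 2)); lra.
Qed.

(** * Cauchy's formula *)

Lemma rderiv_pair (f g : R -> R) (t u v : R) :
  is_derive f t u -> is_derive g t v -> rderiv (fun t => (f t, g t)) t (u, v).
Proof.
intros [_ Hf] [_ Hg] eps Heps.
destruct (Hf t (fun P HP => HP) (mkposreal (eps / 2) ltac:(lra))) as [d1 D1].
destruct (Hg t (fun P HP => HP) (mkposreal (eps / 2) ltac:(lra))) as [d2 D2].
exists (Rmin d1 d2); split; [apply Rmin_pos; apply cond_pos|]; intros x Hx.
specialize (D1 x (Rlt_le_trans _ _ _ Hx (Rmin_l _ _))).
specialize (D2 x (Rlt_le_trans _ _ _ Hx (Rmin_r _ _))).
change (Rabs ((f x - f t) - (x - t) * u) <= eps / 2 * Rabs (x - t)) in D1.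
change (Rabs ((g x - g t) - (x - t) * v) <= eps / 2 * Rabs (x - t)) in D2.
eapply Rle_trans; [apply Cmod_fst_snd_le|]; simpl.
match goal with |- Rabs ?a + Rabs ?b <= _ =>
  replace a with ((f x - f t) - (x - t) * u) by ring;
  replace b with ((g x - g t) - (x - t) * v) by ring end.
lra.
Qed.

Definition circle (r t : R) : C := (r * cos t, r * sin t).
Definition dcircle (r t : R) : C := (r * - sin t, r * cos t).

Lemma circle_rderiv (r t : R) : rderiv (circle r) t (dcircle r t).
Proof.
apply rderiv_pair; apply is_derive_scal; [apply is_derive_cos|apply is_derive_sin].
Qed.

Lemma dcircle_Ci (r t : R) : dcircle r t = (Ci * circle r t)%C.
Proof. unfold dcircle, circle, Ci, Cmult; simpl; f_equal; ring. Qed.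

Lemma circle_ccont (r t : R) : ccont (circle r) t.
Proof. apply (rderiv_ccont _ _ (dcircle r t)), circle_rderiv. Qed.

Lemma dcircle_ccont (r t : R) : ccont (dcircle r) t.
Proof.
apply (ccont_ext (fun t => Ci * circle r t)%C).
- intros u; symmetry; apply dcircle_Ci.
- apply ccont_scal, circle_ccont.
Qed.

Lemma Cmod_circle (r t : R) : 0 <= r -> Cmod (circle r t) = r.
Proof.
intros Hr; unfold Cmod, circle; simpl.
replace (r * cos t * (r * cos t * 1) + r * sin t * (r * sin t * 1)) with
  (Rsqr r * (Rsqr (sin t) + Rsqr (cos t))) by (unfold Rsqr; ring).
rewrite sin2_cos2, Rmult_1_r; apply sqrt_Rsqr, Hr.
Qed.

Lemma circle_closed (r : R) : circle r (2 * PI) = circle r 0.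
Proof. unfold circle; rewrite cos_2PI, sin_2PI, cos_0, sin_0; reflexivity. Qed.

(** Differentiation under the integral sign: a quadratic remainder uniform in [t] simply integrates
    to a quadratic remainder. *)
Lemma cderiv_CInt (k k' : C -> R -> C) (z : C) (a b d M : R) : a <= b -> 0 < d ->
  (forall w, Cmod (w - z) < d -> ccont_on (k w) a b) -> ccont_on (k' z) a b ->
  (forall w t, Cmod (w - z) < d -> a <= t <= b ->
    Cmod (k w t - k z t - k' z t * (w - z)) <= M * (Cmod (w - z)) ^ 2) ->
  cderiv (fun w => CInt (k w) a b) z (CInt (k' z) a b).
Proof.
intros Hab Pd Hk Hk' HM.
assert (Z : Cmod (z - z) < d).
{ replace (z - z)%C with (RtoC 0) by ring; rewrite Cmod_0; exact Pd. }
apply cderiv_quadratic_error with (d := d) (M := (b - a) * M); [exact Pd|].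
intros w Hw.
assert (E : (CInt (k w) a b - CInt (k z) a b - CInt (k' z) a b * (w - z))%C =
  CInt (fun t => k w t - k z t - (w - z) * k' z t)%C a b).
{ rewrite (CInt_minus (fun t => k w t - k z t)%C), CInt_minus, CInt_scal; auto.
  - ring.
  - intros t Ht; apply ccont_minus; [apply Hk|apply Hk]; assumption.
  - intros t Ht; apply ccont_scal, Hk', Ht. }
rewrite E, Rmult_assoc; apply CInt_bound; [exact Hab| |].
- intros t Ht; apply ccont_minus; [apply ccont_minus; apply Hk; assumption|].
  apply ccont_scal, Hk', Ht.
- intros t Ht; rewrite (Cmult_comm (w - z)); apply HM; assumption.
Qed.

Lemma ccont_inv_sub (c : R -> C) (w : C) (t : R) : ccont c t -> c t <> w ->
  ccont (fun t => / (c t - w))%C t.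
Proof.
intros Hc Hw; apply (ccont_comp (fun z => / (z - w))%C c t _ (cderiv_inv w (c t) Hw) Hc).
Qed.

(* With [P = 1 / (u - z)], [Q = 1 / (u - w)] and [h = w - z], the resolvent identity
   [Q - P = h P Q] gives [Q - P - h P^2 = h^2 P^2 Q] and
   [Q^2 - P^2 - 2 h P^3 = h^2 P^2 Q (Q + 2 P)]. *)
Lemma cauchy_kernel_errors (u z w : C) (m : R) : 0 < m ->
  m <= Cmod (u - z) -> Cmod (w - z) < m / 2 ->
  Cmod (/ (u - w) - / (u - z) - (/ (u - z) * / (u - z)) * (w - z)) <=
    2 * / m ^ 3 * Cmod (w - z) ^ 2 /\
  Cmod (/ (u - w) * / (u - w) - / (u - z) * / (u - z)
        - 2 * (/ (u - z) * (/ (u - z) * / (u - z))) * (w - z)) <=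
    8 * / m ^ 4 * Cmod (w - z) ^ 2.
Proof.
intros Pm Hz Hw.
assert (Hu : m / 2 <= Cmod (u - w)).
{ generalize (Cmod_triangle_inv (u - z) (w - z)).
  replace (u - z - (w - z))%C with (u - w)%C by ring; lra. }
assert (Nz : (u - z)%C <> 0%C) by (apply Cmod_sub_neq_0; lra).
assert (Nw : (u - w)%C <> 0%C) by (apply Cmod_sub_neq_0; lra).
assert (BP : Cmod (/ (u - z)) <= / m).
{ rewrite Cmod_inv by exact Nz; apply Rinv_le_contravar; lra. }
assert (BQ : Cmod (/ (u - w)) <= 2 * / m).
{ rewrite Cmod_inv by exact Nw.
  replace (2 * / m) with (/ (m / 2)) by (field; lra).
  apply Rinv_le_contravar; lra. }
assert (R : (/ (u - w))%C = (/ (u - z) + (w - z) * (/ (u - z) * / (u - w)))%C)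
  by (field; auto).
set (P := (/ (u - z))%C) in *; set (Q := (/ (u - w))%C) in *.
set (h := (w - z)%C) in *.
assert (E1 : (Q - P - P * P * h = h * h * (P * P * Q))%C).
{ replace (Q - P - P * P * h)%C with
    (Q - (P + h * (P * Q)) + h * P * (Q - (P + h * (P * Q))) + h * h * (P * P * Q))%C
    by ring.
  rewrite <- R; ring. }
assert (E2 : (Q * Q - P * P - 2 * (P * (P * P)) * h =
  h * h * (P * P * Q * (Q + 2 * P)))%C).
{ replace (Q * Q - P * P - 2 * (P * (P * P)) * h)%C with
    ((Q - P) * (Q + P) - 2 * (P * P * h) * P)%C by ring.
  replace (P * P * h)%C with (Q - P - h * h * (P * P * Q))%C by (rewrite <- E1; ring).
  replace ((Q - P) * (Q + P) - 2 * (Q - P - h * h * (P * P * Q)) * P)%C with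
    ((Q - P) * (Q - P) + 2 * (h * h * (P * P * Q)) * P)%C by ring.
  replace (Q - P)%C with (h * (P * Q))%C by (rewrite R at 2; ring).
  ring. }
clearbody P Q.
assert (P0 := Cmod_ge_0 P); assert (Q0 := Cmod_ge_0 Q); assert (h0 := Cmod_ge_0 h).
assert (Pi : 0 < / m) by (apply Rinv_0_lt_compat, Pm).
(* From [|P| <= 1/m] and [|Q| <= 2/m] comes the constant [2 / m^3]; the extra factor
   [|Q + 2 P| <= 4/m] makes it [8 / m^4]. *)
assert (PPQ : Cmod P * Cmod P * Cmod Q <= / m * / m * (2 * / m)).
{ apply Rmult_le_compat; try assumption; [apply Rmult_le_pos; assumption|].
  apply Rmult_le_compat; assumption. }
rewrite E1, E2, !Cmod_mult; split.
- replace (2 * / m ^ 3 * Cmod h ^ 2) with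
    (Cmod h * Cmod h * (/ m * / m * (2 * / m))) by (field; lra).
  apply Rmult_le_compat_l; [apply Rmult_le_pos|]; assumption.
- replace (8 * / m ^ 4 * Cmod h ^ 2) with
    (Cmod h * Cmod h * (/ m * / m * (2 * / m) * (4 * / m))) by (field; lra).
  apply Rmult_le_compat_l; [apply Rmult_le_pos; assumption|].
  apply Rmult_le_compat; try assumption.
  + repeat apply Rmult_le_pos; assumption.
  + apply Cmod_ge_0.
  + eapply Rle_trans; [apply Cmod_triangle|].
    rewrite Cmod_mult, Cmod_R, Rabs_right by lra; lra.
Qed.

(** Two successive derivatives of a Cauchy integral with any continuous density [f]. The second one
    is what makes the derivative of a holomorphic function differentiable. *)
Lemma cauchy_transform_cderiv (f c : R -> C) (a b m : R) (z : C) :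
  a <= b -> 0 < m -> ccont_on f a b -> ccont_on c a b ->
  (forall t, a <= t <= b -> m <= Cmod (c t - z)) ->
  cderiv (fun w => CInt (fun t => f t * / (c t - w))%C a b) z
    (CInt (fun t => f t * (/ (c t - z) * / (c t - z)))%C a b) /\
  cderiv (fun w => CInt (fun t => f t * (/ (c t - w) * / (c t - w)))%C a b) z
    (CInt (fun t => f t * (2 * (/ (c t - z) * (/ (c t - z) * / (c t - z)))))%C a b).
Proof.
intros Hab Pm Hf Hc Hm.
destruct (ccont_bounded f a b Hf) as [B [PB HB]].
assert (Hi : forall w, Cmod (w - z) < m / 2 ->
  ccont_on (fun t => / (c t - w))%C a b).
{ intros w Hw t Ht; apply ccont_inv_sub; [apply Hc, Ht|]; intros E.
  specialize (Hm t Ht); rewrite E in Hm; lra. }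
assert (Hz : ccont_on (fun t => / (c t - z))%C a b).
{ apply Hi; replace (z - z)%C with (RtoC 0) by ring; rewrite Cmod_0; lra. }
split.
- apply (cderiv_CInt (fun w t => f t * / (c t - w))%C
    (fun z t => f t * (/ (c t - z) * / (c t - z)))%C z a b (m / 2) (B * (2 * / m ^ 3)));
    try lra.
  + intros w Hw t Ht; apply ccont_mult; [apply Hf|apply (Hi w Hw)]; exact Ht.
  + intros t Ht; repeat apply ccont_mult; [apply Hf|apply Hz|apply Hz]; exact Ht.
  + intros w t Hw Ht.
    replace (f t * / (c t - w) - f t * / (c t - z) -
      f t * (/ (c t - z) * / (c t - z)) * (w - z))%C with
      (f t * (/ (c t - w) - / (c t - z) - (/ (c t - z) * / (c t - z)) * (w - z)))%C by ring.
    rewrite Cmod_mult, Rmult_assoc; apply Rmult_le_compat; try apply Cmod_ge_0; auto.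
    apply cauchy_kernel_errors; auto.
- apply (cderiv_CInt (fun w t => f t * (/ (c t - w) * / (c t - w)))%C
    (fun z t => f t * (2 * (/ (c t - z) * (/ (c t - z) * / (c t - z)))))%C
    z a b (m / 2) (B * (8 * / m ^ 4))); try lra.
  + intros w Hw t Ht; repeat apply ccont_mult; [apply Hf|apply (Hi w Hw)|apply (Hi w Hw)];
      exact Ht.
  + intros t Ht; repeat apply ccont_mult;
      [apply Hf|apply ccont_const|apply Hz|apply Hz|apply Hz]; exact Ht.
  + intros w t Hw Ht.
    replace (f t * (/ (c t - w) * / (c t - w)) - f t * (/ (c t - z) * / (c t - z)) -
      f t * (2 * (/ (c t - z) * (/ (c t - z) * / (c t - z)))) * (w - z))%C with
      (f t * (/ (c t - w) * / (c t - w) - / (c t - z) * / (c t - z)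
        - 2 * (/ (c t - z) * (/ (c t - z) * / (c t - z))) * (w - z)))%C by ring.
    rewrite Cmod_mult, Rmult_assoc; apply Rmult_le_compat; try apply Cmod_ge_0; auto.
    apply cauchy_kernel_errors; auto.
Qed.

Definition radial_int (h : C -> C) (z : C) : C :=
  CInt (fun s => h (s * z) * z)%C 0 1.

Lemma radial_ccont (h : C -> C) (r : R) (z : C) :
  (forall w, Cmod w < r -> exists l, cderiv h w l) -> Cmod z < r ->
  ccont_on (fun s => h (s * z))%C 0 1.
Proof.
intros Hh Hz s Hs.
destruct (Hh (s * z)%C) as [l Hl].
{ rewrite Cmod_mult, Cmod_R, Rabs_right by lra; generalize (Cmod_ge_0 z); nra. }
apply (ccont_comp h (fun s => s * z)%C s l Hl).
apply ccont_mult; [apply ccont_RtoC|apply ccont_const].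
Qed.

(** The fundamental theorem along the segment from 0 to [z]: a primitive is determined by its value
    at 0. *)
Lemma primitive_radial_int (F h : C -> C) (r : R) (z : C) :
  (forall w, Cmod w < r -> cderiv F w (h w)) ->
  (forall w, Cmod w < r -> exists l, cderiv h w l) -> Cmod z < r ->
  radial_int h z = (F z - F 0)%C.
Proof.
intros HF Hh Hz.
replace (F z - F 0)%C with (F (0 + 1 * z) - F (0 + 0 * z))%C
  by (f_equal; [|f_equal]; f_equal; ring).
apply (CInt_FTC (fun s => F (0 + RtoC s * z)%C)); [lra| |].
- intros s Hs; rewrite <- (Cplus_0_l (s * z)).
  apply (rderiv_comp F (fun s => 0 + RtoC s * z)%C); [|apply rderiv_line].
  apply HF; rewrite Cplus_0_l, Cmod_mult, Cmod_R, Rabs_right by lra.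
  generalize (Cmod_ge_0 z); nra.
- intros s Hs; apply ccont_mult; [|apply ccont_const].
  apply (radial_ccont h r z Hh Hz s Hs).
Qed.

Lemma cderiv_const (k z : C) : cderiv (fun _ => k) z 0%C.
Proof.
apply cderiv_quadratic_error with (d := 1) (M := 0); [lra|]; intros w _.
replace (k - k - 0 * (w - z))%C with (RtoC 0) by ring; rewrite Cmod_0; lra.
Qed.

Lemma cderiv_zero_constant (F : C -> C) (r : R) (z : C) :
  (forall w, Cmod w < r -> cderiv F w 0%C) -> Cmod z < r -> F z = F 0%C.
Proof.
intros HF Hz.
assert (E := primitive_radial_int F (fun _ => RtoC 0) r z HF
  (fun w _ => ex_intro _ _ (cderiv_const 0 w)) Hz).
replace (F z) with ((F z - F 0) + F 0)%C by ring; rewrite <- E; unfold radial_int.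
rewrite (CInt_ext _ (fun _ => RtoC 0)) by (try lra; intros; ring).
rewrite CInt_const; ring.
Qed.

Lemma Cmod_circle_sub (r t : R) (z : C) : 0 <= r ->
  r - Cmod z <= Cmod (circle r t - z).
Proof. intros Hr; rewrite <- (Cmod_circle r t Hr) at 1; apply Cmod_triangle_inv. Qed.

(** As a function of [a] the integral has derivative 0, because [1 / (u - a)^2] has a primitive
    along the closed circle. So it is constant, and at [a = 0] the integrand is the constant
    [Ci]. *)
Lemma circle_winding (r : R) (a : C) : 0 < r -> Cmod a < r ->
  CInt (fun t => dcircle r t * / (circle r t - a))%C 0 (2 * PI) = (2 * PI * Ci)%C.
Proof.
intros Hr Ha; assert (HPI := PI_RGT_0).
rewrite (cderiv_zero_constant (fun a =>
  CInt (fun t => dcircle r t * / (circle r t - a))%C 0 (2 * PI)) r a); [| |exact Ha].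
- rewrite (CInt_ext _ (fun _ => Ci)); [rewrite CInt_const|lra|].
  + rewrite Rminus_0_r, RtoC_mult; reflexivity.
  + intros t _; rewrite dcircle_Ci.
    assert (N : circle r t <> 0%C) by (apply Cmod_gt_0; rewrite Cmod_circle; lra).
    replace (circle r t - 0)%C with (circle r t) by ring; field; exact N.
- intros z Hz.
  assert (Hm : forall t, r - Cmod z <= Cmod (circle r t - z)).
  { intros t; apply Cmod_circle_sub; lra. }
  assert (Hne : forall t, circle r t <> z).
  { intros t E; specialize (Hm t); rewrite E in Hm.
    replace (z - z)%C with (RtoC 0) in Hm by ring; rewrite Cmod_0 in Hm; lra. }
  assert (E : CInt (fun t => dcircle r t * (/ (circle r t - z) * / (circle r t - z)))%C
    0 (2 * PI) = 0%C).
  { rewrite (CInt_ext _ (fun t => - (1) *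
      (- / ((circle r t - z) * (circle r t - z)) * dcircle r t))%C) by
      (try lra; intros t _; specialize (Hne t); field; intros X; apply Hne;
       replace (circle r t) with ((circle r t - z) + z)%C by ring; rewrite X; ring).
    assert (Hd : forall t, rderiv (fun t => / (circle r t - z))%C t
      (- / ((circle r t - z) * (circle r t - z)) * dcircle r t)%C).
    { intros t; apply (rderiv_comp (fun u => / (u - z))%C (circle r));
        [apply cderiv_inv, Hne|apply circle_rderiv]. }
    assert (Hcont : ccont_on (fun t =>
      - / ((circle r t - z) * (circle r t - z)) * dcircle r t)%C 0 (2 * PI)).
    { intros t _.
      apply (ccont_ext (fun t => - (1) * (/ (circle r t - z) * / (circle r t - z)) *
        dcircle r t)%C).
      - intros u; specialize (Hne u); field; intros X; apply Hne;
          replace (circle r u) with ((circle r u - z) + z)%C by ring; rewrite X; ring.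
      - repeat apply ccont_mult; try apply ccont_const; try apply dcircle_ccont;
          apply ccont_inv_sub; auto; apply circle_ccont. }
    rewrite CInt_scal by (try lra; exact Hcont).
    rewrite (CInt_FTC (fun t => / (circle r t - z))%C) by (try lra; auto).
    rewrite circle_closed; ring. }
  rewrite <- E.
  refine (proj1 (cauchy_transform_cderiv (dcircle r) (circle r) 0 (2 * PI) (r - Cmod z) z
    _ _ _ _ _)); try lra.
  + intros t _; apply dcircle_ccont.
  + intros t _; apply circle_ccont.
  + intros t _; apply Hm.
Qed.

(* Goursat on the cone with apex [a] over the circle, truncated near the apex, shows
   that [J s] below does not depend on [s]; it tends to [h a * 2 * PI * i] at [s = 0]. *)
Lemma cauchy_formula (h : C -> C) (r : R) (a : C) : 0 < r < 1 -> Cmod a < r ->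
  (forall z, disc z -> exists l, cderiv h z l) ->
  CInt (fun t => h (circle r t) * dcircle r t * / (circle r t - a))%C 0 (2 * PI)
  = (2 * PI * Ci * h a)%C.
Proof.
intros Hr Ha Hh; assert (HPI := PI_RGT_0).
assert (Hm : forall t, r - Cmod a <= Cmod (circle r t - a)).
{ intros t; apply Cmod_circle_sub; lra. }
assert (Hne : forall t, (circle r t - a)%C <> 0%C).
{ intros t; apply Cmod_sub_neq_0; specialize (Hm t); lra. }
assert (Hne' : forall t, circle r t <> a).
{ intros t E; apply (Hne t); rewrite E; ring. }
set (c := fun t => (circle r t - a)%C).
assert (Hc : forall t, ccont c t).
{ intros t; apply ccont_minus; [apply circle_ccont|apply ccont_const]. }
assert (Hdc : forall t, rderiv c t (dcircle r t)).
{ intros t eps Heps; destruct (circle_rderiv r t eps Heps) as [e [P D]].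
  exists e; split; [exact P|]; intros u Hu; specialize (D u Hu); unfold c.
  replace (circle r u - a - (circle r t - a) - dcircle r t * (u - t)%R)%C with
    (circle r u - circle r t - dcircle r t * (u - t)%R)%C by ring; exact D. }
assert (Hin : forall s t, 0 <= s <= 1 -> disc (a + s * c t)%C).
{ intros s t Hs; unfold disc, c.
  replace (a + s * (circle r t - a))%C with ((1 - s)%R * a + s * circle r t)%C
    by (rewrite RtoC_minus; ring).
  eapply Rle_lt_trans; [apply Cmod_triangle|].
  rewrite !Cmod_mult, !Cmod_R, Cmod_circle, !Rabs_right by lra; nra. }
(* On the curve [a + s c] the form [h(z) dz / (z - a)] loses its factor [s], so [J] makes sense at
   [s = 0] as well. *)
set (kern := fun t => (dcircle r t * / c t)%C).
assert (Hkern : forall t, ccont kern t).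
{ intros t; apply ccont_mult; [apply dcircle_ccont|].
  apply ccont_inv_sub; [apply circle_ccont|apply Hne']. }
set (J := fun s : R => CInt (fun t => h (a + s * c t) * kern t)%C 0 (2 * PI)).
assert (Hint : forall s, 0 <= s <= 1 ->
  ccont_on (fun t => h (a + s * c t) * kern t)%C 0 (2 * PI)).
{ intros s Hs t _; apply ccont_mult; [|apply Hkern].
  destruct (Hh _ (Hin s t Hs)) as [l Hl].
  apply (ccont_comp h (fun t => a + s * c t)%C t l Hl).
  apply ccont_plus; [apply ccont_const|apply ccont_scal, Hc]. }
assert (HJ : forall e, 0 < e <= 1 -> J 1 = J e).
{ intros e He.
  assert (G := cone_goursat (fun z => h z * / (z - a))%C a c (dcircle r) e 1 0 (2 * PI)).
  unfold cone_int in G.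
  assert (EJ : forall s, 0 < s <= 1 ->
    arc_int (fun z => h z * / (z - a))%C a c (dcircle r) s 0 (2 * PI) = J s).
  { intros s Hs; apply CInt_ext; [lra|]; intros t _; unfold kern.
    replace (a + s * c t - a)%C with (s * c t)%C by ring.
    assert (RtoC s <> 0%C) by (intros X; apply RtoC_inj in X; lra).
    assert (c t <> 0%C) by apply Hne.
    field; auto. }
  (* The circle closes up, so the two rays of the truncated cone coincide and cancel. *)
  assert (ER : ray_int (fun z => h z * / (z - a))%C a c (2 * PI) e 1 =
    ray_int (fun z => h z * / (z - a))%C a c 0 e 1).
  { unfold ray_int, c; rewrite circle_closed; reflexivity. }
  rewrite !EJ, ER in G by lra.
  replace (J 1) with ((J 1 - J e - ray_int (fun z => h z * / (z - a))%C a c 0 e 1 +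
    ray_int (fun z => h z * / (z - a))%C a c 0 e 1) + J e)%C by ring.
  rewrite G; try lra; [ring| | |].
  - intros t _; apply Hdc.
  - intros t _; apply dcircle_ccont.
  - intros s t Hs _.
    destruct (Hh (a + s * c t)%C (Hin s t ltac:(lra))) as [l Hl].
    eexists; apply cderiv_mult; [exact Hl|apply cderiv_inv].
    intros E.
    assert (X : (s * c t)%C = 0%C).
    { replace (s * c t)%C with (a + s * c t - a)%C by ring; rewrite E; ring. }
    revert X; apply Cmult_neq_0; [|apply Hne].
    intros X; apply RtoC_inj in X; lra. }
assert (E1 : CInt (fun t => h (circle r t) * dcircle r t * / (circle r t - a))%C
  0 (2 * PI) = J 1).
{ apply CInt_ext; [lra|]; intros t _; unfold kern, c.
  replace (a + 1 * (circle r t - a))%C with (circle r t) by ring; ring. }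
rewrite E1.
assert (EK : CInt kern 0 (2 * PI) = (2 * PI * Ci)%C) by (apply circle_winding; lra).
rewrite <- EK.
destruct (ccont_bounded kern 0 (2 * PI) (fun t _ => Hkern t)) as [B [PB HB]].
assert (Small : forall eps, 0 < eps ->
  Cmod (J 1 - CInt kern 0 (2 * PI) * h a) <= 2 * PI * (eps * B)).
{ intros eps Heps.
  assert (Da : disc a) by (unfold disc; lra).
  destruct (Hh a Da) as [l Hl].
  destruct (cderiv_continuous h a l Hl eps Heps) as [d [Pd Hd]].
  (* As [|c t| <= 2], the point [a + e c(t)] stays within [d / 2] of [a]. *)
  set (e := Rmin (1 / 2) (d / 4)).
  assert (Pe : 0 < e) by (apply Rmin_pos; lra).
  assert (Le := Rmin_l (1 / 2) (d / 4)); fold e in Le.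
  assert (Le' := Rmin_r (1 / 2) (d / 4)); fold e in Le'.
  rewrite (HJ e) by lra; rewrite Cmult_comm.
  unfold J; rewrite <- CInt_scal by (try lra; intros t _; apply Hkern).
  rewrite <- CInt_minus; [|lra|apply Hint; lra|intros t _; apply ccont_scal, Hkern].
  replace (2 * PI * (eps * B)) with ((2 * PI - 0) * (eps * B)) by ring.
  apply CInt_bound; [lra| |].
  - intros t Ht; apply ccont_minus; [apply Hint; lra|apply ccont_scal, Hkern].
  - intros t Ht.
    replace (h (a + e * c t) * kern t - h a * kern t)%C with
      ((h (a + e * c t) - h a) * kern t)%C by ring.
    rewrite Cmod_mult; apply Rmult_le_compat; try apply Cmod_ge_0; [|apply HB, Ht].
    left; apply Hd.
    replace (a + e * c t - a)%C with (e * c t)%C by ring.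
    rewrite Cmod_mult, Cmod_R, Rabs_right by lra.
    assert (X : Cmod (c t) <= 2).
    { eapply Rle_trans; [apply Cmod_sub_triangle|]; rewrite Cmod_circle; lra. }
    assert (Y := Cmod_ge_0 (c t)); nra. }
replace (J 1) with ((J 1 - CInt kern 0 (2 * PI) * h a) + CInt kern 0 (2 * PI) * h a)%C
  by ring.
set (D := (J 1 - CInt kern 0 (2 * PI) * h a)%C) in *; clearbody D.
assert (E : D = 0%C); [|rewrite E; ring].
apply Cmod_eq_0, Rle_antisym; [|apply Cmod_ge_0]; apply Rnot_lt_le; intros N.
(* This [eps] turns the bound into [|D| / 2], impossible for [D <> 0]. *)
specialize (Small (Cmod D / (4 * PI * B))).
replace (2 * PI * (Cmod D / (4 * PI * B) * B)) with (Cmod D / 2) in Small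
  by (field; lra).
enough (Cmod D <= Cmod D / 2) by lra.
apply Small, Rdiv_lt_0_compat; [exact N|]; apply Rmult_lt_0_compat; lra.
Qed.

Lemma C_derive_cderiv (f : C -> C) (z l : C) : cderiv f z l -> C_derive f z = l.
Proof. intros H; apply is_C_derive_unique, is_derive_cderiv, H. Qed.

(** Near [z], Cauchy's formula writes the derivative as an integral against [1 / (u - w)^2], which
    can be differentiated once more. The radius [r] halfway between [|z|] and 1 keeps the circle
    inside the disc and around [z]. *)
Lemma holomorphic_C_derive (h : C -> C) (z : C) :
  (forall z, disc z -> exists l, cderiv h z l) -> disc z ->
  exists l, cderiv (C_derive h) z l.
Proof.
intros Hh Hz; unfold disc in Hz; assert (HPI := PI_RGT_0).
assert (Z := Cmod_ge_0 z).
set (r := (1 + Cmod z) / 2); assert (Hr : 0 < r < 1) by (unfold r; lra).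
assert (Hzr : Cmod z < r) by (unfold r; lra).
set (f := fun t => (h (circle r t) * dcircle r t)%C).
assert (Hf : ccont_on f 0 (2 * PI)).
{ intros t _; apply ccont_mult; [|apply dcircle_ccont].
  destruct (Hh (circle r t)) as [l Hl]; [unfold disc; rewrite Cmod_circle; lra|].
  exact (ccont_comp h (circle r) t l Hl (circle_ccont r t)). }
assert (Hc : ccont_on (circle r) 0 (2 * PI)) by (intros t _; apply circle_ccont).
set (k := (/ (2 * PI * Ci))%C).
assert (Nk : (2 * PI * Ci)%C <> 0%C).
{ repeat apply Cmult_neq_0.
  - intros E; apply RtoC_inj in E; lra.
  - intros E; apply RtoC_inj in E; lra.
  - intros E; apply (f_equal snd) in E; simpl in E; lra. }
assert (HC : forall w, Cmod w < r -> cderiv h w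
  (k * CInt (fun t => f t * (/ (circle r t - w) * / (circle r t - w)))%C 0 (2 * PI))%C).
{ intros w Hw.
  apply (cderiv_ext_loc (fun w => k * CInt (fun t => f t * / (circle r t - w))%C
    0 (2 * PI))%C h w _ (r - Cmod w)); [lra| |].
  - intros v Hv.
    assert (Hv' : Cmod v < r).
    { replace v with ((v - w) + w)%C by ring.
      eapply Rle_lt_trans; [apply Cmod_triangle|lra]. }
    unfold f; rewrite (cauchy_formula h r v Hr Hv' Hh); unfold k;
      rewrite Cmult_assoc, Cinv_l by exact Nk; ring.
  - apply cderiv_scal.
    refine (proj1 (cauchy_transform_cderiv f (circle r) 0 (2 * PI) (r - Cmod w) w
      _ _ Hf Hc _)); try lra.
    intros t _; apply Cmod_circle_sub; lra. }
eexists.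
apply (cderiv_ext_loc (fun w => k * CInt (fun t =>
  f t * (/ (circle r t - w) * / (circle r t - w)))%C 0 (2 * PI))%C _ z _ (r - Cmod z));
  [lra| |].
- intros w Hw; symmetry; apply C_derive_cderiv, HC.
  replace w with ((w - z) + z)%C by ring.
  eapply Rle_lt_trans; [apply Cmod_triangle|lra].
- apply cderiv_scal.
  refine (proj2 (cauchy_transform_cderiv f (circle r) 0 (2 * PI) (r - Cmod z) z
    _ _ Hf Hc _)); try lra.
  intros t _; apply Cmod_circle_sub; lra.
Qed.

(** * The Volterra operator *)

(* Path independence is Goursat on the triangle with vertices [0], [z], [w], which is
   the cone with apex [0] over the segment from [z] to [w]. *)
Lemma radial_int_cderiv (h : C -> C) (z : C) :
  (forall w, disc w -> exists l, cderiv h w l) -> disc z ->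
  cderiv (radial_int h) z (h z).
Proof.
intros Hh Hz; unfold disc in Hz.
destruct (Hh z Hz) as [l Hl]; intros eps Heps.
destruct (cderiv_continuous h z l Hl eps Heps) as [d [Pd Hd]].
exists (Rmin d (1 - Cmod z)); split; [apply Rmin_pos; lra|]; intros w Hw.
assert (Hwd := Rlt_le_trans _ _ _ Hw (Rmin_l _ _)).
assert (Hw1 := Rlt_le_trans _ _ _ Hw (Rmin_r _ _)).
set (c := fun t : R => (z + t * (w - z))%C).
assert (Hc : forall t, 0 <= t <= 1 -> Cmod (c t - z) <= Cmod (w - z)).
{ intros t Ht; unfold c; replace (z + t * (w - z) - z)%C with (t * (w - z))%C by ring.
  rewrite Cmod_mult, Cmod_R, Rabs_right by lra; generalize (Cmod_ge_0 (w - z)); nra. }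
assert (Hc1 : forall t, 0 <= t <= 1 -> Cmod (c t) < 1).
{ intros t Ht; replace (c t) with ((c t - z) + z)%C by ring.
  eapply Rle_lt_trans; [apply Cmod_triangle|]; specialize (Hc t Ht); lra. }
assert (Hin : forall s t, 0 <= s <= 1 -> 0 <= t <= 1 -> disc (0 + s * c t)%C).
{ intros s t Hs Ht; unfold disc.
  rewrite Cplus_0_l, Cmod_mult, Cmod_R, Rabs_right by lra.
  specialize (Hc1 t Ht); generalize (Cmod_ge_0 (c t)); nra. }
assert (G := cone_goursat h 0%C c (fun _ => (w - z)%C) 0 1 0 1); unfold cone_int in G.
(* At the apex the arc degenerates to a point; the rays at [t = 0] and [t = 1] are the radial
   integrals at [z] and [w]. *)
assert (E0 : arc_int h 0%C c (fun _ => (w - z)%C) 0 0 1 = 0%C).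
{ unfold arc_int; rewrite (CInt_ext _ (fun _ => RtoC 0)) by (try lra; intros; ring).
  rewrite CInt_const; ring. }
assert (ER : forall t u, c t = u -> ray_int h 0%C c t 0 1 = radial_int h u).
{ intros t u <-; apply CInt_ext; [lra|]; intros s _; rewrite Cplus_0_l; reflexivity. }
rewrite E0, (ER 1 w), (ER 0 z) in G by (unfold c; ring).
assert (Hhc : ccont_on (fun t => h (c t)) 0 1).
{ intros t Ht; destruct (Hh (c t) (Hc1 t Ht)) as [m Hm].
  exact (ccont_comp h c t m Hm (rderiv_ccont _ _ _ (rderiv_line z (w - z) t))). }
assert (EA : arc_int h 0%C c (fun _ => (w - z)%C) 1 0 1 =
  ((w - z) * CInt (fun t => h (c t)) 0 1)%C).
{ rewrite <- CInt_scal by (try lra; exact Hhc).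
  apply CInt_ext; [lra|]; intros t _.
  replace (0 + 1 * c t)%C with (c t) by ring; ring. }
assert (EF : (radial_int h w - radial_int h z)%C =
  ((w - z) * CInt (fun t => h (c t)) 0 1)%C).
{ rewrite <- EA; clear EA.
  set (A := arc_int h 0%C c (fun _ => (w - z)%C) 1 0 1) in *.
  replace (radial_int h w - radial_int h z)%C with
    (A - (A - 0 - radial_int h w + radial_int h z))%C by ring.
  rewrite G; try lra; [ring| | |].
  - intros t _; apply rderiv_line.
  - intros t _; apply ccont_const.
  - intros s t Hs Ht; apply Hh, Hin; assumption. }
rewrite EF.
(* Writing [h z] as its own mean over the unit interval reduces the error to the mean of
   [h (c t) - h z]; the factor [1 - 0] matches [CInt_const]. *)
replace ((w - z) * CInt (fun t => h (c t)) 0 1 - h z * (w - z))%C with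
  ((w - z) * (CInt (fun t => h (c t)) 0 1 - (1 - 0)%R * h z))%C
  by (rewrite RtoC_minus; ring).
rewrite <- CInt_const, <- CInt_minus; try lra; [|exact Hhc|intros t _; apply ccont_const].
rewrite Cmod_mult, Rmult_comm; apply Rmult_le_compat_r; [apply Cmod_ge_0|].
replace eps with ((1 - 0) * eps) by ring.
apply CInt_bound; [lra| |].
- intros t Ht; apply ccont_minus; [apply Hhc, Ht|apply ccont_const].
- intros t Ht; left; apply Hd; specialize (Hc t Ht); lra.
Qed.

Lemma HD_cderiv (f : HD) (z : C) : disc z -> exists l, cderiv f z l.
Proof. intros Hz; apply ex_derive_cderiv, HD_holo, Hz. Qed.

Definition volterra_integrand (g f : HD) (z : C) : C := (f z * C_derive g z)%C.

Lemma volterra_integrand_cderiv (g f : HD) (z : C) : disc z ->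
  exists l, cderiv (volterra_integrand g f) z l.
Proof.
intros Hz; destruct (HD_cderiv f z Hz) as [l Hl].
destruct (holomorphic_C_derive g z (HD_cderiv g) Hz) as [m Hm].
eexists; exact (cderiv_mult f (C_derive g) z l m Hl Hm).
Qed.

(** This gives access to [epsilon_spec]. The witness is cut off to 0 outside the disc, as [HD]
    demands. *)
Lemma volterra_exists (g f : HD) : exists F : HD,
  F 0%C = 0%C /\ forall z, disc z -> is_derive F z (f z * C_derive g z)%C.
Proof.
set (h := volterra_integrand g f).
set (F := fun z => if Rlt_dec (Cmod z) 1 then radial_int h z else 0%C).
assert (HF : forall z, disc z -> is_derive F z (h z)).
{ intros z Hz; apply is_derive_cderiv.
  apply (cderiv_ext_loc (radial_int h) F z _ (1 - Cmod z)).
  - unfold disc in Hz; lra.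
  - intros w Hw; unfold F; destruct (Rlt_dec (Cmod w) 1) as [|N]; [reflexivity|].
    exfalso; apply N; replace w with ((w - z) + z)%C by ring.
    eapply Rle_lt_trans; [apply Cmod_triangle|lra].
  - apply radial_int_cderiv; [apply volterra_integrand_cderiv|exact Hz]. }
assert (HFoff : forall z, ~ disc z -> F z = 0%C).
{ intros z Hz; unfold F; destruct (Rlt_dec (Cmod z) 1); [contradiction|reflexivity]. }
exists (mkHD F (fun z Hz => ex_intro _ _ (HF z Hz)) HFoff); split; [|exact HF].
simpl; unfold F; destruct (Rlt_dec (Cmod 0) 1) as [_|]; [|reflexivity].
unfold radial_int; rewrite (CInt_ext _ (fun _ => RtoC 0)) by (try lra; intros; ring).
rewrite CInt_const; ring.
Qed.

(** Replaces the chosen antiderivative by an explicit integral, from which linearity and continuity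
    in [f] are read off. *)
Lemma volterra_radial_int (g f : HD) (z : C) : disc z ->
  volterra g f z = radial_int (volterra_integrand g f) z.
Proof.
intros Hz.
destruct (epsilon_spec (inhabits HD_zero) _ (volterra_exists g f)) as [V0 VD].
fold (volterra g f) in V0, VD.
rewrite (primitive_radial_int (volterra g f) _ 1 z).
- rewrite V0; ring.
- intros w Hw; apply is_derive_cderiv, VD, Hw.
- apply volterra_integrand_cderiv.
- exact Hz.
Qed.

Lemma volterra_linear (g f k : HD) (c z : C) : disc z ->
  volterra g (HD_plus f (HD_scal c k)) z = (volterra g f z + c * volterra g k z)%C.
Proof.
intros Hz; rewrite !volterra_radial_int by exact Hz; unfold radial_int.
assert (HC : forall f, ccont_on (fun s => volterra_integrand g f (s * z) * z)%C 0 1).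
{ intros f' t Ht; apply ccont_mult; [|apply ccont_const].
  apply (radial_ccont _ 1 z (volterra_integrand_cderiv g f') Hz t Ht). }
rewrite <- CInt_scal, <- CInt_plus; try lra; try apply HC.
- apply CInt_ext; [lra|]; intros s _; unfold volterra_integrand; simpl; ring.
- intros t Ht; apply ccont_scal, HC, Ht.
Qed.

(** [B] bounds [g'(s z) z] on the segment, hence is the same for all [f]. It depends on [z]: a
    uniform bound would make every image of a bounded function bounded. *)
Lemma volterra_pointwise_bound (g : HD) (z : C) : disc z ->
  exists B, 0 < B /\ forall (f : HD) (N : R), 0 <= N ->
    (forall w, disc w -> Cmod (f w) <= N) -> Cmod (volterra g f z) <= N * B.
Proof.
intros Hz; unfold disc in Hz.
destruct (ccont_bounded (fun s => C_derive g (s * z) * z)%C 0 1) as [B [PB HB]].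
{ intros t Ht; apply ccont_mult; [|apply ccont_const].
  refine (radial_ccont (C_derive g) 1 z _ Hz t Ht).
  intros w; apply holomorphic_C_derive, HD_cderiv. }
exists B; split; [exact PB|]; intros f N HN Hf.
rewrite volterra_radial_int by exact Hz.
replace (N * B) with ((1 - 0) * (N * B)) by ring.
apply CInt_bound; [lra| |].
- intros t Ht; apply ccont_mult; [|apply ccont_const].
  apply (radial_ccont _ 1 z (volterra_integrand_cderiv g f) Hz t Ht).
- intros t Ht; unfold volterra_integrand.
  rewrite <- Cmult_assoc, Cmod_mult.
  apply Rmult_le_compat; try apply Cmod_ge_0; [|apply HB, Ht].
  apply Hf; unfold disc; rewrite Cmod_mult, Cmod_R, Rabs_right by lra.
  generalize (Cmod_ge_0 z); nra.
Qed.

(** * Topology of the set of functions with unbounded image *)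

Lemma elt_norm_ge_0 (E : bounded_subspace) (f : bs_elt E) : 0 <= elt_norm E f.
Proof.
eapply Rle_trans; [apply (Cmod_ge_0 (f 0%C))|].
apply elt_norm_ub; unfold disc; rewrite Cmod_0; lra.
Qed.

Lemma volterra_large_open (E : bounded_subspace) (g : HD) (z : C) (M : R) : disc z ->
  open (fun f : bs_elt E => M < Cmod (volterra g f z)).
Proof.
intros Hz f Hf.
destruct (volterra_pointwise_bound g z Hz) as [B [PB HB]].
(* Within this radius of [f] the value at [z] of the image moves by less than its gap above [M]. *)
assert (Peps : 0 < (Cmod (volterra g f z) - M) / B) by (apply Rdiv_lt_0_compat; lra).
exists (mkposreal _ Peps); intros k Hk.
change (elt_norm E (minus k f) < (Cmod (volterra g f z) - M) / B) in Hk.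
apply Rmult_lt_compat_r with (1 := PB) in Hk.
replace ((Cmod (volterra g f z) - M) / B * B) with (Cmod (volterra g f z) - M) in Hk
  by (field; lra).
assert (L := HB (minus k f : bs_elt E) _ (elt_norm_ge_0 E _) (elt_norm_ub E (minus k f))).
change (bs_val (minus k f : bs_elt E)) with (HD_plus k (HD_scal (- (1))%C f)) in L.
rewrite volterra_linear in L by exact Hz.
assert (T := Cmod_triangle_inv (volterra g f z) (volterra g k z)).
assert (T' := Cmod_triangle_inv (volterra g f z) (volterra g f z - volterra g k z)).
replace (volterra g f z - (volterra g f z - volterra g k z))%C with (volterra g k z)
  in T' by ring.
replace (volterra g k z + - (1) * volterra g f z)%C with
  (- (volterra g f z - volterra g k z))%C in L by ring.
rewrite Cmod_opp in L; lra.
Qed.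

Lemma open_exists {T : UniformSpace} {I : Type} (Q : I -> Prop) (U : I -> T -> Prop) :
  (forall i, Q i -> open (U i)) -> open (fun x => exists i, Q i /\ U i x).
Proof.
intros H x [i [Qi Ux]].
apply (filter_imp (U i)); [intros y Uy; exists i; auto|exact (H i Qi x Ux)].
Qed.

Lemma unbounded_volterra_G_delta (E : bounded_subspace) (g : HD) :
  G_delta (fun f : bs_elt E => ~ in_Hinf (volterra g f)).
Proof.
exists (fun n (f : bs_elt E) =>
  exists z, disc z /\ INR n < Cmod (volterra g f z)); split.
- intros n; apply open_exists; intros z Hz; apply volterra_large_open, Hz.
- intros f; split.
  + intros H n; apply NNPP; intros N; apply H; exists (INR n); intros z Hz.
    apply Rnot_lt_le; intros L; apply N; exists z; auto.
  + intros H [M HM].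
    (* [nfloor_ex] wants a nonnegative number, hence [Rmax 0 M]; the index used is [S n], since only
       [n + 1] exceeds [M]. *)
    destruct (nfloor_ex (Rmax 0 M) (Rmax_l 0 M)) as [n Hn].
    destruct (H (S n)) as [z [Hz L]].
    specialize (HM z Hz); rewrite S_INR in L; generalize (Rmax_r 0 M); lra.
Qed.

Lemma unbounded_volterra_dense (E : bounded_subspace) (g : HD) :
  (exists f : bs_elt E, ~ in_Hinf (volterra g f)) ->
  dense (fun f : bs_elt E => ~ in_Hinf (volterra g f)).
Proof.
intros [f1 H1] U HU [f0 U0].
destruct (classic (in_Hinf (volterra g f0))) as [H0|H0]; [|exists f0; auto].
destruct (HU f0 U0) as [eps Heps].
assert (N1 := elt_norm_ge_0 E f1); assert (Pe := cond_pos eps).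
(* This gives [c |f1| <= eps / 2]; the half restores the strict inequality, as [sup_norm_le] yields
   only a weak one. *)
set (c := eps / 2 / (1 + elt_norm E f1)).
assert (Pc : 0 < c) by (apply Rdiv_lt_0_compat; lra).
exists (elt_plus E f0 (elt_scal E c f1)); split.
- apply Heps.
  change (sup_norm (minus (elt_plus E f0 (elt_scal E c f1)) f0 : bs_elt E) < eps).
  apply Rle_lt_trans with (eps / 2); [|lra].
  apply sup_norm_le; intros z Hz; simpl.
  replace (f0 z + c * f1 z + - (1) * f0 z)%C with (c * f1 z)%C by ring.
  rewrite Cmod_mult, Cmod_R, Rabs_right by lra.
  replace (eps / 2) with (c * (1 + elt_norm E f1)) by (unfold c; field; lra).
  apply Rmult_le_compat_l; [lra|]; generalize (elt_norm_ub E f1 z Hz); lra.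
(* The image of [f1] is the difference of the images of [f0 + c f1] and [f0], divided by [c]. *)
- intros [M HM]; destruct H0 as [M0 HM0]; apply H1; exists ((M + M0) / c).
  intros z Hz; specialize (HM z Hz); specialize (HM0 z Hz).
  change (bs_val (elt_plus E f0 (elt_scal E c f1))) with (HD_plus f0 (HD_scal c f1)) in HM.
  rewrite volterra_linear in HM by exact Hz.
  apply Rmult_le_reg_l with c; [exact Pc|].
  replace (c * ((M + M0) / c)) with (M + M0) by (field; lra).
  rewrite <- (Rabs_right c) at 1 by lra; rewrite <- Cmod_R, <- Cmod_mult.
  replace (c * volterra g f1 z)%C with
    ((volterra g f0 z + c * volterra g f1 z) - volterra g f0 z)%C by ring.
  eapply Rle_trans; [apply Cmod_sub_triangle|lra].
Qed.

Theorem proposition7p2 (g : HD) :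
  ((exists f : AD, Y1 g f) -> (dense (Y1 g) /\ G_delta (Y1 g)) /\ residual (Y2 g)) /\
  ((exists f : Hinf, Y3 g f) -> (dense (Y3 g) /\ G_delta (Y3 g)) /\ residual (Y4 g)).
Proof.
split; intros H.
- assert (D := unbounded_volterra_dense AD_subspace g H).
  assert (G := unbounded_volterra_G_delta AD_subspace g).
  split; [exact (conj D G)|].
  (* [Y1 g] itself is the dense G-delta set inside [Y2 g], by boundedness of functions in [A(D)]. *)
  exists (Y1 g); split; [exact D|]; split; [exact G|].
  intros f Hf HA; apply Hf, in_AD_bounded, HA.
- assert (D := unbounded_volterra_dense Hinf_subspace g H).
  assert (G := unbounded_volterra_G_delta Hinf_subspace g).
  split; [exact (conj D G)|].
  exists (Y3 g); split; [exact D|]; split; [exact G|].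
  intros f Hf HA; apply Hf, in_AD_bounded, HA.
Qed.
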